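(* Let $\mathcal{G}$ be a compact tree (a compact connected metric graph without cycles) and suppose $\mathcal{P}=\{\mathcal{G}_1,\dots,\mathcal{G}_k\}$ is an exhaustive Dirichlet $k$-equipartition of $\mathcal{G}$, $k\ge 2$. Then $\mathcal{P}$ is nodal, that is, $\mathcal{P}$ is the nodal partition associated with some eigenfunction of the Laplacian with natural vertex conditions on $\mathcal{G}$.
   Context: Metric graphs: a metric graph $\mathcal{G}$ consists of finitely many edges (compact intervals of positive finite length) whose set of endpoints is divided into nonempty disjoint classes, the vertices, the endpoints in a class being identified. Graphs differing only by relabelling or by insertion/removal of vertices of degree two are identified, so any point of an edge may be regarded as a vertex. The Laplacian with natural vertex conditions is $-\frac{d^2}{dx^2}$ with continuity and Kirchhoff conditions (the sum of inward-pointing derivatives is zero) at every vertex. Partitions: a cut of $\mathcal{G}$ is a metric graph with the same edges (for a suitable representative of $\mathcal{G}$) such that each of its vertex classes is contained in a vertex class of $\mathcal{G}$; a vertex of $\mathcal{G}$ is cut nontrivially if its class is split into at least two classes. A $k$-partition $\mathcal{P}=\{\mathcal{G}_1,\dots,\mathcal{G}_k\}$ of $\mathcal{G}$ is a set of $k$ distinct connected components (clusters) of some cut of $\mathcal{G}$; it is exhaustive if there is such a cut of which these are all the components. The support $\Omega_i$ of $\mathcal{G}_i$ is the closed subset of $\mathcal{G}$ made of the edges of $\mathcal{G}_i$, with topological boundary $\partial\Omega_i$ in $\mathcal{G}$; the support of $\mathcal{P}$ is $\bigcup_i\Omega_i$. The cut set of $\mathcal{P}$ is the set of vertices of $\mathcal{G}$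 in $\bigcup_i\Omega_i$ that are cut nontrivially; $\mathcal{V}_D(\mathcal{G}_i)\subset\mathcal{G}_i$ is the set of vertices of $\mathcal{G}_i$ obtained by nontrivially cutting vertices of $\mathcal{G}$. A partition is rigid if its cut set equals $\bigcup_i\partial\Omega_i$, and internally connected if it is rigid and $\Omega_i\setminus\partial\Omega_i$ is connected for all $i$. $\lambda_1(\mathcal{G}_i)$ is the smallest eigenvalue of the Laplacian on $\mathcal{G}_i$ with Dirichlet conditions at $\mathcal{V}_D(\mathcal{G}_i)$ and natural conditions at all other vertices. $\mathcal{P}$ is a Dirichlet $k$-equipartition if $\lambda_1(\mathcal{G}_1)=\dots=\lambda_1(\mathcal{G}_k)$. The nodal partition associated with an eigenfunction $\psi$ of the Laplacian with natural vertex conditions on $\mathcal{G}$ is the unique internally connected, possibly non-exhaustive partition whose support is the union of the edges of $\mathcal{G}$ on which $\psi$ does not vanish identically and whose cut set is the zero set of $\psi$ on that support.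
   Formalization: It is additionally assumed that each support minus its boundary is connected; every nodal partition satisfies this by definition, and without it the claim fails (star with edges of length 1, 1/2, 1 whose centre is cut into {e1,e2} and {e3}). *)

(* Defs.v *)
(* MathComp and MathComp-Analysis *)
From HB Require Import structures.
From mathcomp Require Import all_boot all_order all_algebra.
From mathcomp Require Import all_classical all_reals all_analysis.

Set Implicit Arguments.
Unset Strict Implicit.
Unset Printing Implicit Defensive.

Import Order.TTheory GRing.Theory Num.Theory.
Import numFieldNormedType.Exports.

Local Open Scope classical_set_scope.
Local Open Scope ring_scope.

(* An edge e is the interval [0, len e]; its endpoints are (e, false), located
   at 0, and (e, true), located at len e.  A graph and its cuts and clusters
   are all graphs on the same ambient family E of edges, so that "the same
   edges" is a literal equality.

   A term of this type is one representative of a metric graph, in which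
   vertices of degree two are allowed anywhere. A theorem about all terms G
   is a theorem about all representatives of all metric graphs; in it, the
   cuts of G along the vertices of G account for all the cuts of the metric
   graph, each being of this form for a suitable representative. *)
Record metric_graph (R : realType) (E : finType) (len : E -> {posnum R}) :=
  MetricGraph {
    edges : {set E};
    vertices : {set {set E * bool}};
    verticesP : finset.partition vertices [set a | a.1 \in edges]%SET
  }.

Section MetricGraph.
Context {R : realType} {E : finType} {len : E -> {posnum R}}.
Implicit Types G H K : metric_graph len.

Definition endpoint_pos (a : E * bool) : E * R :=
  (a.1, if a.2 then (len a.1)%:num else 0).

Definition other_endpoint (a : E * bool) : E * bool := (a.1, ~~ a.2).

Definition same_vertex G : rel (E * bool) :=
  fun a b => [exists v in vertices G, (a \in v) && (b \in v)].

(* The quotient of the disjoint union of the edges by the gluing of their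
   endpoints is not formed: the several elements of graph_point G located at one
   vertex are related by same_point, and the open sets are those of the
   quotient topology, pulled back, i.e. the relatively open sets that are
   saturated for same_point. All the sets considered below are saturated. *)
Definition graph_point G : Type :=
  {p : E * R | (p.1 \in edges G) && (0 <= p.2 <= (len p.1)%:num)}.

HB.instance Definition _ G := Choice.on (graph_point G).

Definition located_at G (p : graph_point G) (v : {set E * bool}) : Prop :=
  exists2 a, a \in v & val p = endpoint_pos a.

Definition same_point G (p q : graph_point G) : Prop :=
  p = q \/ exists v, [/\ v \in vertices G, located_at p v & located_at q v].

Definition graph_open G (U : set (graph_point G)) : Prop :=
  (forall p q, same_point p q -> U p -> U q) /\
  (forall p, U p -> exists2 eps : R, 0 < eps &
     forall q : graph_point G, (val q).1 = (val p).1 ->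
       `|(val q).2 - (val p).2| < eps -> U q).

Fact graph_openT G : graph_open [set: graph_point G].
Proof. by split=> // p _; exists 1. Qed.

Fact graph_openI G : setI_closed (@graph_open G).
Proof.
move=> U V [Us Uo] [Vs Vo]; split=> [p q pq [Up Vp]|p [Up Vp]].
  by split; [exact: Us Up|exact: Vs Vp].
have [e e0 eU] := Uo _ Up; have [f f0 fV] := Vo _ Vp.
exists (Num.min e f); first by rewrite lt_min e0.
by move=> q qp; rewrite lt_min => /andP[? ?]; split; [exact: eU|exact: fV].
Qed.

Fact graph_open_bigU G (I : Type) (U : I -> set (graph_point G)) :
  (forall i, graph_open (U i)) -> graph_open (\bigcup_i U i).
Proof.
move=> oU; split=> [p q pq [i _ Uip]|p [i _ Uip]].
  by exists i => //; have [+ _] := oU i; apply; [exact: pq|].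
have [_ /(_ _ Uip)[e e0 eU]] := oU i.
by exists e => // q qp pqe; exists i => //; exact: eU.
Qed.

HB.instance Definition _ G := isOpenTopological.Build (graph_point G)
  (@graph_openT G) (@graph_openI G) (@graph_open_bigU G).

Definition connected_graph G : Prop := connected [set: graph_point G].

(* A cycle is listed by the endpoints at which its successive edges are
   entered; its edges and its vertices are pairwise distinct. Loops (length
   one) and pairs of parallel edges (length two) are cycles. *)
Definition is_cycle G (c : seq (E * bool)) : Prop :=
  [/\ c != [::],
      path.cycle (fun a b => same_vertex G (other_endpoint a) b) c,
      uniq (map fst c) &
      uniq (map (finset.pblock (vertices G)) c)].

Definition is_tree G : Prop :=
  connected_graph G /\ ~ exists c, is_cycle G c.

Definition is_cut G H : Prop :=
  edges H = edges G /\
  forall w, w \in vertices H -> exists2 v, v \in vertices G & w \subset v.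

(* The vertices of K are full vertices of H and partition the endpoints of
   the edges of K, so no vertex of H touches both an edge in K and an edge
   outside K: K is open and closed in H. *)
Definition is_component H K : Prop :=
  [/\ edges K != finset.set0, edges K \subset edges H,
      vertices K \subset vertices H & connected_graph K].

(* A k-partition is an enumeration of its k clusters. *)
Definition is_partition G k (P : 'I_k -> metric_graph len) : Prop :=
  injective P /\
  exists2 H, is_cut G H & forall i, is_component H (P i).

Definition is_exhaustive_partition G k (P : 'I_k -> metric_graph len) : Prop :=
  injective P /\
  exists2 H, is_cut G H &
    forall K, is_component H K <-> exists i, K = P i.

(* Closed subset of G made of a family S of edges of G. *)
Definition edge_union G (S : set E) : set (graph_point G) :=
  [set p | exists2 q, same_point p q & S (val q).1].

Definition cluster_support G K : set (graph_point G) :=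
  edge_union [set e | e \in edges K].
#[global] Arguments cluster_support : clear implicits.

Definition boundary G (A : set (graph_point G)) : set (graph_point G) :=
  closure A `\` interior A.

Definition partition_support G k (P : 'I_k -> metric_graph len) :
  set (graph_point G) := \bigcup_i cluster_support G (P i).
#[global] Arguments partition_support G {k} P.

(* A vertex v of G lying in the cluster P i contains a vertex w of P i, and it
   is cut nontrivially iff w is not the whole of v. *)
Definition cut_set G k (P : 'I_k -> metric_graph len) : set (graph_point G) :=
  [set p | exists v, [/\ v \in vertices G, located_at p v &
    exists i, exists2 w, w \in vertices (P i) & w \proper v]].
#[global] Arguments cut_set G {k} P.

Definition dirichlet_vertices G K : {set {set E * bool}} :=
  [set w in vertices K | [exists v in vertices G, w \proper v]]%SET.

Definition is_rigid G k (P : 'I_k -> metric_graph len) : Prop :=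
  cut_set G P = \bigcup_i boundary (cluster_support G (P i)).

(* In a tree this excludes Dirichlet vertices of degree at least two in their
   cluster, such as the centre of the cluster {e1, e2} when the centre of a
   star with edges e1, e2, e3 is cut into {e1, e2} and {e3}. *)
Definition has_connected_interiors G k (P : 'I_k -> metric_graph len) : Prop :=
  forall i, connected
    (cluster_support G (P i) `\` boundary (cluster_support G (P i))).

Definition is_internally_connected G k (P : 'I_k -> metric_graph len) : Prop :=
  is_rigid G P /\ has_connected_interiors G P.

(* A function on G is a family psi of functions on the edges; the values of
   psi e outside [0, len e] are irrelevant. *)
Definition endpoint_value (psi : E -> R -> R) (a : E * bool) : R :=
  psi a.1 (endpoint_pos a).2.

Definition inward_derivative (dpsi : E -> R -> R) (a : E * bool) : R :=
  if a.2 then - endpoint_value dpsi a else endpoint_value dpsi a.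

Definition nonzero_on_edge (psi : E -> R -> R) (e : E) : Prop :=
  exists2 x, 0 <= x <= (len e)%:num & psi e x != 0.

(* Eigenfunctions of the Laplacian on K with Dirichlet conditions at the
   vertices in D and natural conditions at the others. Continuity of dpsi up
   to the ends of the edges makes its values there the one-sided derivatives
   of psi. *)
Definition is_eigenfunction K (D : {set {set E * bool}}) (mu : R)
    (psi : E -> R -> R) : Prop :=
  (exists2 e, e \in edges K & nonzero_on_edge psi e) /\
  exists dpsi : E -> R -> R,
  [/\ forall e, e \in edges K ->
        {within `[0, (len e)%:num], continuous (psi e)} /\
        {within `[0, (len e)%:num], continuous (dpsi e)},
      forall e x, e \in edges K -> 0 < x < (len e)%:num ->
        is_derive x 1 (psi e) (dpsi e x) /\
        is_derive x 1 (dpsi e) (- (mu * psi e x)),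
      forall v a b, v \in vertices K -> a \in v -> b \in v ->
        endpoint_value psi a = endpoint_value psi b,
      forall v a, v \in vertices K -> v \in D -> a \in v ->
        endpoint_value psi a = 0 &
      forall v, v \in vertices K -> v \notin D ->
        \sum_(a in v) inward_derivative dpsi a = 0].

Definition is_natural_eigenfunction G (mu : R) (psi : E -> R -> R) : Prop :=
  is_eigenfunction G finset.set0 mu psi.

Definition is_eigenvalue K (D : {set {set E * bool}}) (mu : R) : Prop :=
  exists psi, is_eigenfunction K D mu psi.

Definition is_lambda1 K (D : {set {set E * bool}}) (mu : R) : Prop :=
  is_eigenvalue K D mu /\ forall nu, is_eigenvalue K D nu -> mu <= nu.

Definition is_dirichlet_equipartition G k (P : 'I_k -> metric_graph len) :
    Prop :=
  exists mu : R, forall i, is_lambda1 (P i) (dirichlet_vertices G (P i)) mu.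

Definition is_nodal_partition G k (P : 'I_k -> metric_graph len)
    (psi : E -> R -> R) : Prop :=
  [/\ is_partition G P,
      is_internally_connected G P,
      partition_support G P =
        edge_union [set e | e \in edges G /\ nonzero_on_edge psi e] &
      cut_set G P =
        partition_support G P `&`
          [set p : graph_point G | psi (val p).1 (val p).2 = 0]].

End MetricGraph.

(* Main.v *)
Require Import Defs.
From mathcomp Require Import all_boot all_order all_algebra.
From mathcomp Require Import all_classical all_reals all_analysis.
From mathcomp Require Import ring lra zify.

(** The eigenfunction is obtained by gluing the ground states of the clusters,
    that is, their first Dirichlet eigenfunctions.

    Three facts make the gluing possible.  First, in a tree the endpoints
    meeting at a vertex lie in different branches ([vertex_separates]).  Hence
    every cut vertex lies on the boundary of each cluster that reaches it, which
    is rigidity ([boundary_cut_set]), and connectedness of the interiors forces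
    every Dirichlet vertex of a cluster to be a leaf of it ([cut_vertex_leaf]).
    Secondly, the ground state of a connected graph whose Dirichlet vertices are
    leaves is positive away from these vertices, and leaves each of them with a
    positive slope ([ground_state]).  Thirdly, as the clusters form a tree, they
    can be weighted by nonzero constants so that at every cut vertex the
    weighted slopes add up to zero ([balancing_coefficients]).  With these
    constants, continuity at a cut vertex is trivial, all values being zero, and
    the balance of the slopes is the Kirchhoff condition; elsewhere both
    conditions hold inside a cluster.  The ground states have a common
    eigenvalue because the partition is an equipartition, and the glued function
    vanishes exactly at the cut vertices.

    Positivity of the ground state is the analytic part.  It is reached by a
    reduction to finitely many unknowns instead of a variational argument in a
    function space.  For a frequency [k], a solution of [f'' = - k^2 f] is
    determined on each half edge by its values at the two ends, and the natural
    vertex conditions say that these values are a stationary point of the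
    quadratic form
      [sum over half edges of w (2 x y - cos (k h) (x^2 + y^2))],
    where [x] is the value at the vertex, [y] the value at the midpoint, [h] the
    length of the half edge and [w = k / sin (k h)].  Using midpoints as
    additional nodes keeps [k h] at most [pi / 2] over the whole relevant range of
    frequencies, so that the weights stay positive and finite, and the form
    becomes degenerate at the latest when the longest edge is half a wavelength.
    The form is negative definite at [k = 0], and replacing a vector by its
    absolute value does not decrease it; by compactness there is a first
    frequency at which it is not negative definite, and it is then degenerate
    along a nonnegative vector ([first_critical_value]), which yields a
    positive eigenfunction.  A smaller eigenvalue is impossible, since the nodal
    values of its eigenfunctions would be in the kernel of a negative definite
    form ([eigenvalue_lower_bound]); hence the eigenvalue found is the first
    one. *)

Set Implicit Arguments.
Unset Strict Implicit.
Unset Printing Implicit Defensive.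

Import Order.TTheory GRing.Theory Num.Theory.
Import numFieldNormedType.Exports.

Local Open Scope classical_set_scope.
Local Open Scope ring_scope.

(** * Endpoints and vertices *)

Section GraphBasics.
Context {R : realType} {E : finType} {len : E -> {posnum R}}.
Implicit Types (G H K : metric_graph len) (a b : E * bool) (v w : {set E * bool}).

Lemma other_endpointK : involutive (@other_endpoint E).
Proof. by case=> e b; rewrite /other_endpoint /= negbK. Qed.

Lemma vertex_edge G v a : v \in vertices G -> a \in v -> a.1 \in edges G.
Proof.
move=> vG av; have /and3P[/eqP covG _ _] := verticesP G.
have : a \in finset.cover (vertices G) by apply/bigcupP; exists v.
by rewrite covG inE.
Qed.

Lemma vertex_at G a : a.1 \in edges G ->
  exists2 v, v \in vertices G & a \in v.
Proof.
move=> aG; have /and3P[/eqP covG _ _] := verticesP G.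
have : a \in finset.cover (vertices G) by rewrite covG inE.
by move=> /bigcupP[v vG av]; exists v.
Qed.

Lemma vertex_inj G v w a : v \in vertices G -> w \in vertices G ->
  a \in v -> a \in w -> v = w.
Proof.
move=> vG wG av aw; have /and3P[_ tG _] := verticesP G.
by rewrite -(finset.def_pblock tG vG av) (finset.def_pblock tG wG aw).
Qed.

Lemma pblock_vertex G v a : v \in vertices G -> a \in v ->
  finset.pblock (vertices G) a = v.
Proof. by move=> vG av; apply: finset.def_pblock => //; have /and3P[] := verticesP G. Qed.

Lemma vertex_neq0 G v : v \in vertices G -> exists a, a \in v.
Proof.
move=> vG; have /and3P[_ _ nG] := verticesP G.
by apply/set0Pn; apply: contraNneq nG => <-.
Qed.

Lemma sum_over_vertices G (F : E * bool -> R) :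
  \sum_(a in [set a | a.1 \in edges G]%SET) F a =
  \sum_(v in vertices G) \sum_(a in v) F a.
Proof. exact: finset.set_partition_big (verticesP G). Qed.

Lemma sum_over_edges (S : {set E}) (F : E * bool -> R) :
  \sum_(a in [set a | a.1 \in S]%SET) F a =
  \sum_(e in S) (F (e, false) + F (e, true)).
Proof.
rewrite (eq_bigl (fun a => (a.1 \in S) && true)) => [|a]; last by rewrite inE andbT.
rewrite (eq_bigr (fun a => F (a.1, a.2))) => [|[]//].
rewrite -(pair_big (mem S) xpredT (fun (e : E) (c : bool) => F (e, c))) /=.
by apply: eq_bigr => e _; rewrite big_bool addrC.
Qed.

(** Connectedness is encoded by invariant families of endpoints, because these
    are what a separation of the topological space produces. *)
Definition edge_connected G : Prop := forall S : {set E * bool},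
  (forall a, a.1 \in edges G -> a \in S -> other_endpoint a \in S) ->
  (forall v a b, v \in vertices G -> a \in v -> b \in v -> a \in S -> b \in S) ->
  (exists2 a, a.1 \in edges G & a \in S) ->
  forall b, b.1 \in edges G -> b \in S.

End GraphBasics.

(** * A vertex of a tree separates its endpoints *)

Section TreeSeparation.
Context {R : realType} {E : finType} {len : E -> {posnum R}}.
Implicit Types (G : metric_graph len) (a b x y z : E * bool) (v w : {set E * bool}).

Lemma same_vertexP G a b :
  reflect (exists v, [/\ v \in vertices G, a \in v & b \in v]) (same_vertex G a b).
Proof.
apply: (iffP existsP) => -[v]; first by move=> /and3P[vG av bv]; exists v.
by case=> vG av bv; exists v; rewrite vG av.
Qed.

Lemma same_vertexE G v a b : v \in vertices G -> a \in v ->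
  same_vertex G a b = (b \in v).
Proof.
move=> vG av; apply/same_vertexP/idP => [[w [wG aw bw]]|bv]; last by exists v.
by rewrite (vertex_inj vG wG av aw).
Qed.

Lemma same_vertex_pblock G a b : same_vertex G a b ->
  finset.pblock (vertices G) a = finset.pblock (vertices G) b.
Proof. by case/same_vertexP => v [vG av bv]; rewrite !(pblock_vertex vG). Qed.

(** The connectedness generated by this relation is that of the graph obtained
    by pulling apart all the endpoints at [v]. *)
Definition step_avoiding G v : rel (E * bool) := fun a b =>
  (b == other_endpoint a) || same_vertex G a b && (a \notin v).

Let turn G v : rel (E * bool) := fun x y =>
  same_vertex G (other_endpoint x) y && (other_endpoint x \notin v).

(** By induction on its length, a trail from [v] back to [v] can be made simple.
    A repeated vertex allows a shortcut.  When no vertex is repeated, an edge can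
    only be repeated by turning back on it, which at an inner position repeats a
    vertex, and at the last one means that the trail returns by the endpoint [a]
    from which it started. *)
Lemma closed_trail_cycle G v a b s :
  v \in vertices G -> a \in v -> b \in v -> a != b ->
  path (turn G v) a s -> other_endpoint (last a s) = b ->
  exists c, is_cycle G c.
Proof.
move=> vG av bv ab; have [n] := ubnP (size s); elim: n s => // n IHn s sn ps lb.
pose pb := finset.pblock (vertices G); pose c := a :: s.
have turnP i : (i < size s)%N ->
    same_vertex G (other_endpoint (nth a c i)) (nth a s i) /\
    other_endpoint (nth a c i) \notin v.
  by move=> si; have /andP[] := pathP a ps i si.
have pbc i j : (i < size c)%N -> (j < size c)%N ->
    pb (nth a c i) = pb (nth a c j) -> same_vertex G (nth a c i) (nth a c j).
  have atv k : (k < size c)%N -> exists2 w, w \in vertices G & nth a c k \in w.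
    case: k => [_|k ks]; first by exists v.
    by have [/same_vertexP[w [wG _ sw]] _] := turnP k ks; exists w.
  move=> /atv[w wG iw] /atv[u uG ju]; rewrite /pb (pblock_vertex wG iw) (pblock_vertex uG ju).
  by move=> wu; apply/same_vertexP; exists w; split=> //; rewrite wu.
have [uv|/(uniqPn (pb a))[i [j [ij]]]] := boolP (uniq (map pb c)); last first.
  rewrite size_map => jc; rewrite !(nth_map a) // ?(ltn_trans ij) // => pij.
  have sv := pbc _ _ (ltn_trans ij jc) jc pij.
  case: j ij jc pij sv => // j ij jc pij; have [svj nvj] := turnP j jc.
  case: i ij pij => [_ _|i ij _] /= sv.
    rewrite (same_vertexE _ vG av) in sv.
    have /same_vertexP[w [wG ow jw]] := svj.
    by rewrite (vertex_inj wG vG jw sv) (negbTE nvj) in ow.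
  have ijs : (i < j)%N by [].
  have js : (j < size s)%N by [].
  have si : (i < size s)%N by exact: ltn_trans js.
  apply: (IHn (take i s ++ drop j s)).
  - rewrite size_cat size_takel ?(ltnW si) // size_drop; lia.
  - have : path (turn G v) a (take i s ++ nth a s i :: drop i.+1 s).
      by rewrite -drop_nth // cat_take_drop.
    rewrite cat_path /= => /andP[pi /andP[/andP[ti nv] _]].
    have : path (turn G v) a (take j s ++ nth a s j :: drop j.+1 s).
      by rewrite -drop_nth // cat_take_drop.
    rewrite cat_path /= => /andP[_ /andP[_ pj]].
    rewrite (drop_nth a js) cat_path pi /= pj andbT.
    have -> : turn G v (last a (take i s)) (nth a s j) => //.
    rewrite /turn nv andbT; have /same_vertexP[w [wG iw jw]] := ti.
    by rewrite (same_vertexE _ wG iw) -(same_vertexE _ wG jw).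
  - rewrite last_cat (drop_nth a js) /=.
    rewrite -lb; congr other_endpoint.
    by rewrite -[in RHS](cat_take_drop j s) last_cat (drop_nth a js).
(* From here on, the vertices of the trail are pairwise distinct. *)
have pb_inj i j : (i < size c)%N -> (j < size c)%N ->
    pb (nth a c i) = pb (nth a c j) -> i = j.
  move=> ic jc pij; apply/eqP; rewrite -(nth_uniq (pb a) _ _ uv) ?size_map //.
  by rewrite !(nth_map a) // pij.
exists c; split=> //.
- rewrite /= rcons_path (sub_path _ ps) /=; last by move=> x y /andP[].
  by rewrite lb (same_vertexE _ vG bv).
- apply/negPn/negP => /(uniqPn a.1)[i [j [ij]]]; rewrite size_map => jc.
  have ic := ltn_trans ij jc; rewrite !(nth_map a) // => eij.
  have oij : other_endpoint (nth a c i) = nth a c j.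
    have : nth a c i <> nth a c j by move=> ne; have := pb_inj i j ic jc (congr1 _ ne); lia.
    move: eij; case: (nth a c i) (nth a c j) => [e d] [e' d'] /= <-.
    by rewrite /other_endpoint /=; case: d d' => [] [].
  have iS : (i < size s)%N by exact: leq_trans ij jc.
  have [ti _] := turnP i iS.
  have ji : i.+1 = j.
    apply: pb_inj => //.
    by rewrite -oij; exact/esym/(same_vertex_pblock ti).
  have [jl|js] := eqVneq j (size s).
    have cib : nth a c i = b.
      by rewrite -lb (last_nth a) -jl -oij other_endpointK.
    have : i = 0%N.
      by apply: pb_inj => //=; rewrite cib /pb (pblock_vertex vG av) (pblock_vertex vG bv).
    by move=> i0; move: cib ab; rewrite i0 /= => ->; rewrite eqxx.
  have js' : (j < size s)%N by rewrite ltn_neqAle js.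
  have [tj _] := turnP j js'.
  have : j.+1 = i.
    apply: pb_inj => //; rewrite -[nth a c i]other_endpointK oij.
    exact/esym/(same_vertex_pblock tj).
  lia.
Qed.

(** A path joining two endpoints at [v] without passing through [v] would close
    up to a cycle. *)
Lemma vertex_separates G v a b : ~ (exists c, is_cycle G c) ->
  v \in vertices G -> a \in v -> b \in v ->
  connect (step_avoiding G v) a b -> a = b.
Proof.
move=> acyc vG av bv /connectP[p pp pb]; apply/eqP/negPn/negP => ab.
(* A path of [step_avoiding] may idle: only its turns are kept, so that it
   becomes a trail listed by the endpoints at which edges are entered. *)
pose W y := exists s, path (turn G v) a s /\
  (other_endpoint (last a s) = y \/ last a s = y).
have turn_v s y z : path (turn G v) a (rcons s y) -> same_vertex G y z ->
    path (turn G v) a (rcons s z).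
  rewrite !rcons_path => /andP[-> /andP[/same_vertexP[w [wG xw yw]] nv]] /=.
  by rewrite (same_vertexE _ wG yw) => zw; rewrite /turn nv (same_vertexE _ wG xw) zw.
have Wstep y z : W y -> step_avoiding G v y z -> W z.
  move=> [s [ps ys]] /orP[/eqP->|/andP[yz nyv]].
    by exists s; split=> //; case: ys => <-; [right; rewrite other_endpointK|left].
  case: ys => ys.
    exists (rcons s z); split; last by right; rewrite last_rcons.
    by rewrite rcons_path ps /turn ys yz nyv.
  case/lastP: s ps ys => [_ /= ay|s x ps]; first by rewrite -ay av in nyv.
  rewrite last_rcons => xy; subst x.
  exists (rcons s z); split; last by right; rewrite last_rcons.
  exact: turn_v ps yz.
have Wb : W b.
  rewrite pb; have : W a by exists [::]; split=> //; right.
  elim: p (a) pp {pb} => //= y p IHp x /andP[xy pp] Wx.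
  by apply: IHp pp _; exact: Wstep Wx xy.
case: Wb => s [ps [lb|lb]]; first by apply: acyc; exact: closed_trail_cycle ps lb.
case/lastP: s ps lb => [_ /= ab'|s x]; first by rewrite ab' eqxx in ab.
rewrite last_rcons rcons_path => /andP[_ /andP[/same_vertexP[w [wG xw yw]] nv]] xb.
by move: nv; rewrite -(vertex_inj wG vG yw) ?xw // xb.
Qed.

End TreeSeparation.

(** * Topology of a metric graph *)

Section GraphTopology.
Context {R : realType} {E : finType} {len : E -> {posnum R}}.
Local Notation pos := (@endpoint_pos R E len).
Implicit Types (G K : metric_graph len) (a b : E * bool) (v w : {set E * bool}).

Lemma graph_openE G (U : set (graph_point G)) : open U = graph_open U.
Proof. by []. Qed.

Lemma endpoint_pos_inj : injective pos.
Proof.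
case=> e c [e' c'] [<-]; case: c c' => [] [] //= /eqP; first by rewrite gt_eqF.
by rewrite lt_eqF.
Qed.

Lemma endpoint_pos_ok G a : a.1 \in edges G ->
  ((pos a).1 \in edges G) &&
  (0 <= (pos a).2 <= (len (pos a).1)%:num).
Proof. by move=> aG; rewrite /endpoint_pos /= aG; case: a.2; rewrite ?lexx ltW. Qed.

Definition endpoint_point G a (aG : a.1 \in edges G) : graph_point G :=
  exist _ (pos a) (endpoint_pos_ok aG).


Lemma edge_point_ok G e x : e \in edges G -> 0 <= x <= (len e)%:num ->
  ((e, x).1 \in edges G) && (0 <= (e, x).2 <= (len (e, x).1)%:num).
Proof. by move=> eG /= xl; rewrite eG. Qed.

Definition edge_point G e x (eG : e \in edges G) (xl : 0 <= x <= (len e)%:num) :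
  graph_point G := exist _ (e, x) (edge_point_ok eG xl).

Lemma located_vertex_inj G (p : graph_point G) v w : v \in vertices G ->
  w \in vertices G -> located_at p v -> located_at p w -> v = w.
Proof.
move=> vG wG [a av pa] [b bw]; rewrite pa => /endpoint_pos_inj ab.
by apply: (vertex_inj vG wG av); rewrite ab.
Qed.

(** The one source of open sets below.  Removing vertices is harmless, and a
    union of edges can only fail to be open at a vertex where it contains some
    of the incident edges but not all of them. *)
Lemma edge_family_open G (Vs : {set {set E * bool}}) (S : {set E}) :
  Vs \subset vertices G ->
  (forall v a b, v \in vertices G -> v \notin Vs -> a \in v -> b \in v ->
     a.1 \in S -> b.1 \in S) ->
  open [set p : graph_point G |
    (forall v, v \in Vs -> ~ located_at p v) /\ (val p).1 \in S].
Proof.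
move=> /fintype.subsetP VsG full; rewrite graph_openE; split.
  move=> p q [->//|[u [uG pu qu]]] [pV pS]; split=> [v vV qv|].
    by apply: (pV v vV); rewrite -(located_vertex_inj uG (VsG _ vV) qu qv).
  have uV : u \notin Vs by apply/negP => /pV; apply.
  case: pu pS => a au -> aS; case: qu => b bu -> /=.
  exact: full au bu aS.
move=> p [pV pS].
(* The radius is smaller than the distances from [p] to the ends of its edge,
   except for an end at which [p] itself is located. *)
pose r c := `|(val p).2 - (pos ((val p).1, c)).2|.
pose d c := if r c == 0 then 1 else r c.
have d_gt0 c : 0 < d c.
  rewrite /d; case: ifPn => // rn; by rewrite lt_neqAle eq_sym rn normr_ge0.
exists (Num.min (d false) (d true)); first by rewrite lt_min !d_gt0.
move=> q qp; rewrite lt_min => /andP[qf qt]; split; last by rewrite qp.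
have qd c : `|(val q).2 - (val p).2| < d c by case: c.
move=> v vV [[e c] av qa]; apply: (pV v vV); exists (e, c) => //.
have pe : (val p).1 = e by rewrite -qp qa.
have := qd c; rewrite /d /r pe qa distrC.
case: ifPn => [|_]; last by rewrite ltxx.
rewrite normr_eq0 subr_eq0 => /eqP pc _.
by rewrite [LHS]surjective_pairing pe pc.
Qed.

Lemma connected_edge_connected G : connected_graph G -> edge_connected G.
Proof.
move=> Gc S Sother Svert [a aG aS] b bG.
(* [S] contains both ends of an edge or none, and so defines a family of edges
   whose points form an open and closed set. *)
pose F : {set E} := [set e | ((e, false) \in S) && (e \in edges G)]%SET.
have otherS c : c.1 \in edges G -> (other_endpoint c \in S) = (c \in S).
  move=> cG; apply/idP/idP => [cS|]; last exact: Sother.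
  by rewrite -[c]other_endpointK; exact: Sother.
have inF c : c.1 \in edges G -> (c.1 \in F) = (c \in S).
  move=> cG; rewrite inE cG andbT; case: c cG => e [] //= eG.
  exact/esym/(otherS (e, false)).
have fullF v c d : v \in vertices G -> c \in v -> d \in v -> c.1 \in F -> d.1 \in F.
  move=> vG cv dv; rewrite !inF ?(vertex_edge vG) //; exact: (Svert v).
pose U := [set p : graph_point G |
  (forall v, v \in finset.set0 -> ~ located_at p v) /\ (val p).1 \in F].
have UE p : U p <-> (val p).1 \in F.
  by split=> [[]//|pF]; split=> // v; rewrite inE.
have Uo : open U.
  apply: edge_family_open => [|v c d vG _]; first exact: finset.sub0set.
  exact: fullF.
have Uc : open (~` U).
  have -> : ~` U = [set p : graph_point G |
      (forall v, v \in finset.set0 -> ~ located_at p v) /\ (val p).1 \in (~: F)%SET].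
    apply/seteqP; split=> p /=; rewrite inE.
      move=> pU; split=> [v|]; first by rewrite inE.
      by apply/negP => pF; apply: pU; rewrite UE.
    by move=> [_ /negP pF] /UE.
  apply: edge_family_open => [|v c d vG _ cv dv]; first exact: finset.sub0set.
  by rewrite !finset.in_setC; apply: contra; exact: (fullF v).
have UT : U = setT.
  apply: Gc.
  - exists (endpoint_point aG); apply/UE; by rewrite /= inF.
  - by exists U => //; rewrite setTI.
  - exists U; last by rewrite setTI.
    by rewrite -[U]setCK; exact: open_closedC.
have : U (endpoint_point bG) by rewrite UT.
by move=> /UE; rewrite -(inF b bG).
Qed.

(** An edge is a continuous image of an interval. *)
Lemma edge_clopen G (U : set (graph_point G)) e x y (eG : e \in edges G)
    (xl : 0 <= x <= (len e)%:num) (yl : 0 <= y <= (len e)%:num) :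
  open U -> open (~` U) -> U (edge_point eG xl) -> U (edge_point eG yl).
Proof.
move=> Uo Uc Ux; pose l := (len e)%:num.
have l0 : 0 <= l by rewrite /l ltW.
(* Clamping extends the parametrization of the edge to the whole real line. *)
pose cl z := Num.min l (Num.max 0 z).
have cl_ok z : 0 <= cl z <= l.
  by rewrite /cl le_min l0 le_max lexx /= ge_min lexx.
have clE z : 0 <= z <= l -> cl z = z.
  by move=> /andP[z0 zl]; rewrite /cl max_r // min_r.
pose F z := edge_point eG (cl_ok z).
have Fo (W : set (graph_point G)) : open W -> open (F @^-1` W).
  rewrite graph_openE => -[_ Wo]; rewrite openE => z Wz.
  have [eps e0 We] := Wo _ Wz; apply/nbhs_ballP; exists eps => //= t.
  rewrite /ball /= => zt; apply: We => //=.
  apply: le_lt_trans zt; rewrite distrC /cl.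
  have := ler_norm (z - t); have := ler_norm (t - z); rewrite (distrC t z) => h1 h2.
  rewrite ler_norml !minEle !maxEle; do ?case: ifPn; rewrite -?ltNge => *; lra.
have FE z (zl : 0 <= z <= l) : F z = edge_point eG zl.
  by apply: val_inj => /=; rewrite clE.
pose B := `[0, l] `&` (F @^-1` U).
have : B = `[0, l]%classic.
  apply: segment_connected.
  - exists x; split; first by rewrite /= in_itv.
    by rewrite /= (FE _ xl).
  - by exists (F @^-1` U) => //; exact: Fo.
  - exists (F @^-1` U) => //; have := open_closedC (Fo _ Uc).
    by rewrite -preimage_setC setCK.
move=> BE; have : B y by rewrite BE /= in_itv.
by case=> _; rewrite /= (FE _ yl).
Qed.

Lemma edge_connected_connected G : edge_connected G -> connected_graph G.
Proof.
move=> Gc B [p Bp] [C Co BC] [C' Cc BC'].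
have Bo : open B by rewrite BC setTI.
have Bc : open (~` B) by rewrite BC' setTI; exact: closed_openC.
pose S : {set E * bool} :=
  [set a | `[< exists q : graph_point G, val q = pos a /\ B q >]]%SET.
have pE (q : graph_point G) : exists eG xl, q = @edge_point G (val q).1 (val q).2 eG xl.
  case: q => -[e x] /= ex; case/andP: (ex) => eG xl; exists eG, xl.
  exact: val_inj.
have along (q r : graph_point G) : (val q).1 = (val r).1 -> B q -> B r.
  have [eG [xl ->]] := pE q; have [e'G [yl ->]] := pE r => /= qr.
  move: (val q).2 xl => x; move: (val q).1 eG qr => e eG qr; subst e => xl.
  have -> : eG = e'G by exact: bool_irrelevance.
  exact: edge_clopen.
have Sall b : b.1 \in edges G -> b \in S.
  apply: Gc => [a aG|v a b' vG av bv|].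
  - rewrite !inE => -[q [qa Bq]].
    exists (@endpoint_point G (other_endpoint a) aG); split=> //.
    by apply: along Bq; rewrite qa.
  - rewrite !inE => -[q [qa Bq]].
    exists (endpoint_point (vertex_edge vG bv)); split=> //.
    have [Bs _] : graph_open B := Bo; apply: Bs Bq.
    by right; exists v; split=> //; [exists a|exists b'].
  - have [eG _] := pE p; exists ((val p).1, false); first exact: eG.
    rewrite inE; apply/asboolP; exists (@endpoint_point G ((val p).1, false) eG).
    by split=> //; apply: along Bp.
apply/seteqP; split=> // q _; have [eG _] := pE q.
have := Sall ((val q).1, false) eG; rewrite inE => /asboolP[r [rq Br]].
by apply: along Br; rewrite rq.
Qed.

End GraphTopology.

(** * Clusters in a tree and their boundaries *)

Section Clusters.
Context {R : realType} {E : finType} {len : E -> {posnum R}}.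
Implicit Types (G H K : metric_graph len) (a b x y : E * bool) (v w : {set E * bool}).
Local Notation pos := (@endpoint_pos R E len).

(** This is what clusters and cuts of [G] have in common. *)
Definition refines G K : Prop :=
  forall w, w \in vertices K -> exists2 v, v \in vertices G & w \subset v.

Lemma refines_edge G K e : refines G K -> e \in edges K -> e \in edges G.
Proof.
move=> KG eK; have [w wK ew] := vertex_at (G := K) (a := (e, true)) eK.
by have [v vG /fintype.subsetP/(_ _ ew)] := KG w wK; exact: vertex_edge.
Qed.

(** If all the edges at [v] were in [K], then [K], being connected, would join
    its vertex [w] to another endpoint at [v] without passing through [v]:
    a passage of [K] at [v] other than through [w] would already be such a
    connection. *)
Lemma dirichlet_vertex_exit G K v w : ~ (exists c, is_cycle G c) ->
  refines G K -> edge_connected K ->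
  v \in vertices G -> w \in vertices K -> w \proper v ->
  exists2 d, d \in v & d.1 \notin edges K.
Proof.
move=> acyc KG Kc vG wK /properP[/fintype.subsetP wv [d dv dw]].
exists d => //; apply/negP => dK.
pose S := [set x | (x.1 \in edges K) &&
  [exists a in w, connect (step_avoiding G v) a x]]%SET.
suff : d \in S.
  rewrite inE dK /= => /exists_inP[a aw /(vertex_separates acyc vG (wv _ aw) dv) ad].
  by rewrite -ad aw in dw.
apply: Kc dK => [x xK|u x y uK xu yu|].
- rewrite inE => /andP[_ /exists_inP[a aw ax]]; rewrite inE; apply/andP.
  split; first exact: xK.
  apply/exists_inP.
  exists a => //; apply: connect_trans ax _; apply: connect1.
  by rewrite /step_avoiding eqxx.
- rewrite !inE => /andP[xK /exists_inP[a aw ax]].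
  rewrite (vertex_edge uK yu); apply/exists_inP.
  have [xv|xv] := boolP (x \in v).
    have ax' := vertex_separates acyc vG (wv _ aw) xv ax.
    by exists y => //; rewrite (vertex_inj wK uK aw) // ax'.
  have [v' v'G /fintype.subsetP uv'] := KG u uK.
  exists a => //; apply: connect_trans ax _; apply: connect1.
  by rewrite /step_avoiding xv (same_vertexE _ v'G (uv' _ xu)) uv' ?orbT.
- have [a aw] := vertex_neq0 wK; exists a; first exact: vertex_edge aw.
  by rewrite inE (vertex_edge wK aw); apply/exists_inP; exists a.
Qed.

Definition cut_at G K : {set {set E * bool}} :=
  [set v in vertices G | [exists w in vertices K, w \proper v]]%SET.

Section Support.
Variables G K : metric_graph len.
Hypothesis KG : refines G K.

Lemma uncut_vertex v a b : v \in vertices G -> v \notin cut_at G K ->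
  a \in v -> b \in v -> a.1 \in edges K -> b.1 \in edges K.
Proof.
move=> vG vK av bv aK; have [w wK aw] := vertex_at aK.
have [u uG wu] := KG wK.
have uv : u = v by apply: (vertex_inj uG vG _ av); exact: (fintype.subsetP wu).
rewrite uv in wu.
have wv : w = v.
  apply/eqP; apply: contraNT vK => wv; rewrite inE vG; apply/exists_inP; exists w => //.
  by rewrite finset.properEneq wv.
by apply: (vertex_edge wK); rewrite wv.
Qed.

Lemma cut_at_sub : cut_at G K \subset vertices G.
Proof. by apply/fintype.subsetP => v; rewrite inE => /andP[]. Qed.

Definition on_edges (Vs : {set {set E * bool}}) (S : {set E}) : set (graph_point G) :=
  [set p | (forall v, v \in Vs -> ~ located_at p v) /\ (val p).1 \in S].

Lemma cluster_part_open : open (on_edges (cut_at G K) (edges K)).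
Proof.
apply: edge_family_open cut_at_sub _ => v a b vG vK av bv.
exact: (uncut_vertex vG vK av bv).
Qed.

Lemma complement_part_open : open (on_edges (cut_at G K) (~: edges K)%SET).
Proof.
apply: edge_family_open cut_at_sub _ => v a b vG vK av bv.
rewrite !finset.in_setC; apply: contra; exact: (uncut_vertex vG vK bv av).
Qed.

Lemma support_uncut p : cluster_support G K p ->
  (forall v, v \in cut_at G K -> ~ located_at p v) -> (val p).1 \in edges K.
Proof.
move=> [q [->//|[v [vG [a av pa] [b bv qb]]]] qK] pcut.
rewrite pa /=; move: qK; rewrite qb /=; apply: (uncut_vertex vG) => //.
by apply/negP => /pcut; apply; exists a.
Qed.

Lemma support_of_edge (p : graph_point G) : (val p).1 \in edges K -> cluster_support G K p.
Proof. by move=> pK; exists p => //; left. Qed.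

(** At an uncut vertex either all edges or no edges belong to [K], so a
    neighbourhood is inside the support or misses it; a vertex at which a proper
    part belongs to [K] has an edge that leaves the support, by hypothesis. *)
Lemma boundaryP (p : graph_point G) :
  (forall v w, v \in vertices G -> w \in vertices K -> w \proper v ->
     exists2 d, d \in v & d.1 \notin edges K) ->
  boundary (cluster_support G K) p <-> exists2 v, v \in cut_at G K & located_at p v.
Proof.
move=> exits; split=> [[pc pni]|[v vcut pv]].
  apply: contrapT => pcut.
  have {}pcut v : v \in cut_at G K -> ~ located_at p v.
    by move=> vc pv; apply: pcut; exists v.
  have [pK|pK] := boolP ((val p).1 \in edges K).
    apply: pni; rewrite /interior nbhsE.
    exists (on_edges (cut_at G K) (edges K)); last by move=> q [_ /support_of_edge].
    by split; [exact: cluster_part_open|].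
  have N : nbhs p (on_edges (cut_at G K) (~: edges K)%SET).
    apply: open_nbhs_nbhs; split; first exact: complement_part_open.
    by split=> //; rewrite finset.in_setC.
  have [q [/support_uncut qK [qcut]]] := pc _ N.
  by rewrite finset.in_setC qK.
move: (vcut); rewrite inE => /andP[vG /exists_inP[w wK wv]]; split.
  apply: subset_closure.
  have [a aw] := vertex_neq0 wK; have aK := vertex_edge wK aw.
  have av : a \in v by move/proper_sub/fintype.subsetP: wv; apply.
  exists (endpoint_point (vertex_edge vG av)) => //.
  by right; exists v; split=> //; exists a.
rewrite /interior nbhsE => -[U [Uo Up] Usub].
have [d dv dK] := exits v w vG wK wv.
have [Us Ueps] : graph_open U := Uo.
have Ud : U (endpoint_point (vertex_edge vG dv)).
  by apply: Us Up; right; exists v; split=> //; exists d.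
(* A point of the edge of [d] that is close to, but distinct from, its end. *)
have [eps e0 Ue] := Ueps _ Ud.
have l0 : 0 < (len d.1)%:num by [].
pose r := Num.min eps (len d.1)%:num / 2.
have r0 : 0 < r by rewrite divr_gt0 // lt_min e0.
have rl : r < (len d.1)%:num.
  by rewrite /r ltr_pdivrMr // (le_lt_trans (y := (len d.1)%:num)) ?ge_min ?lexx ?orbT //; lra.
have re : r < eps.
  by rewrite /r ltr_pdivrMr // (le_lt_trans (y := eps)) ?ge_min ?lexx //; lra.
pose x := if d.2 then (len d.1)%:num - r else r.
have xin : 0 < x < (len d.1)%:num by rewrite /x; case: d.2; lra.
have xl : 0 <= x <= (len d.1)%:num by case/andP: xin => ? ?; rewrite !ltW.
have Ux : U (edge_point (vertex_edge vG dv) xl).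
  apply: Ue => //=; rewrite /x; case: d.2.
    by rewrite addrAC subrr sub0r normrN gtr0_norm.
  by rewrite subr0 gtr0_norm.
have [q [xq|[u [_ [a au xa] _]]] qK] := Usub _ Ux.
  by move: dK; move: qK; rewrite -xq /= => ->.
case: xa => ea xa; move: xin; rewrite xa /= -ea.
by case: a.2; rewrite ltxx ?andbF.
Qed.

Lemma interior_support :
  (forall v w, v \in vertices G -> w \in vertices K -> w \proper v ->
     exists2 d, d \in v & d.1 \notin edges K) ->
  cluster_support G K `\` boundary (cluster_support G K) =
  on_edges (cut_at G K) (edges K).
Proof.
move=> exits; apply/seteqP; split=> p.
  move=> [pK pb]; have pcut v : v \in cut_at G K -> ~ located_at p v.
    by move=> vc pv; apply: pb; apply/boundaryP => //; exists v.
  by split=> //; exact: support_uncut.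
move=> [pcut pK]; split; first exact: support_of_edge.
by move/(boundaryP _ exits) => [v vc pv]; exact: pcut pv.
Qed.

Definition midpoint e (eG : e \in edges G) : graph_point G.
Proof.
by exists (e, (len e)%:num / 2); rewrite /= eG divr_ge0 //= ler_pdivrMr // ler_peMr // ler1n.
Defined.

Lemma midpoint_free e (eG : e \in edges G) v : ~ located_at (midpoint eG) v.
Proof.
move=> [a _ [ea xa]]; have l0 : 0 < (len e)%:num by [].
by move: xa; rewrite -ea; case: a.2 => h; clear ea; lra.
Qed.

(** Two edges of [K] meeting in a Dirichlet vertex are in different branches of
    the tree at [v]; as [v] is a boundary point, the interior of the support
    would be disconnected. *)
Lemma dirichlet_vertex_leaf v w a b : ~ (exists c, is_cycle G c) ->
  (forall v w, v \in vertices G -> w \in vertices K -> w \proper v ->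
     exists2 d, d \in v & d.1 \notin edges K) ->
  connected (cluster_support G K `\` boundary (cluster_support G K)) ->
  v \in vertices G -> w \in vertices K -> w \proper v ->
  a \in w -> b \in w -> a = b.
Proof.
move=> acyc exits + vG wK wv aw bw; rewrite interior_support // => Kc.
have /fintype.subsetP wv' := proper_sub wv.
have [av bv] := (wv' _ aw, wv' _ bw).
have [aK bK] := (vertex_edge wK aw, vertex_edge wK bw).
have [aG bG] := (vertex_edge vG av, vertex_edge vG bv).
have vcut : v \in cut_at G K by rewrite inE vG; apply/exists_inP; exists w.
pose con := connect (step_avoiding G v) a.
pose S : {set E} := [set e | con (e, false)]%SET.
have conO x : con x -> con (other_endpoint x).
  by move=> /connect_trans; apply; apply: connect1; rewrite /step_avoiding eqxx.
have inS x : (x.1 \in S) = con x.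
  rewrite inE; case: x => e [] //=; apply/idP/idP => /conO //.
have full u x y : u \in vertices G -> u \notin [set v]%SET -> x \in u -> y \in u ->
    x.1 \in S -> y.1 \in S.
  rewrite inE !inS => uG uv xu yu /connect_trans; apply; apply: connect1.
  rewrite /step_avoiding (same_vertexE _ uG xu) yu /=; apply/orP; right.
  by apply: contra uv => xv; rewrite (vertex_inj uG vG xu xv).
have vs : [set v]%SET \subset vertices G by rewrite finset.sub1set.
have Oo : open (on_edges [set v]%SET S) by exact: edge_family_open.
have Oo' : open (on_edges [set v]%SET (~: S)%SET).
  apply: edge_family_open vs _ => u x y uG uv xu yu.
  by rewrite !finset.in_setC; apply: contra; exact: (full u).
have offv p : on_edges (cut_at G K) (edges K) p ->
    forall u, u \in [set v]%SET -> ~ located_at p u.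
  by move=> [pcut _] u; rewrite inE => /eqP->; exact: pcut.
have BE : on_edges (cut_at G K) (edges K) `&` on_edges [set v]%SET S =
    on_edges (cut_at G K) (edges K).
  apply: Kc.
  - exists (midpoint aG); split; split=> [u|].
    + by move=> _; exact: midpoint_free.
    + exact: aK.
    + by move=> _; exact: midpoint_free.
    + by rewrite [_ \in _]inS /con connect0.
  - by exists (on_edges [set v]%SET S).
  - exists (~` (on_edges [set v]%SET (~: S)%SET)); first exact: open_closedC.
    apply/seteqP; split=> p [pK pS]; split=> //.
      by move=> [_]; rewrite finset.in_setC (proj2 pS).
    split; first exact: offv.
    apply/negPn/negP => pn; apply: pS; split; first exact: offv.
    by rewrite finset.in_setC.
have : on_edges (cut_at G K) (edges K) (midpoint bG).
  by split=> // u _; exact: midpoint_free.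
rewrite -BE => -[_ [_]]; rewrite [_ \in _]inS => ab.
exact: (vertex_separates acyc vG av bv ab).
Qed.

End Support.

End Clusters.

(** * Components of a cut *)

Section Components.
Context {R : realType} {E : finType} {len : E -> {posnum R}}.
Implicit Types (G H K : metric_graph len) (a b x y : E * bool) (v w : {set E * bool}).

Lemma metric_graph_ext K K' : edges K = edges K' -> vertices K = vertices K' -> K = K'.
Proof.
case: K K' => [F V p] [F' V' p'] /= FE VE; move: p p'; rewrite FE VE => p p'.
by congr MetricGraph; exact: bool_irrelevance.
Qed.

Lemma component_vertex H K v a : is_component H K -> v \in vertices H ->
  a \in v -> a.1 \in edges K -> v \in vertices K.
Proof.
move=> [_ _ /fintype.subsetP VH _] vH av aK; have [w wK aw] := vertex_at aK.
by rewrite (vertex_inj vH (VH _ wK) av aw).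
Qed.

Lemma component_subset H K K' e : is_component H K -> is_component H K' ->
  e \in edges K -> e \in edges K' -> edges K \subset edges K'.
Proof.
move=> HK HK' eK eK'; have [_ _ /fintype.subsetP VH Kc] := HK.
apply/fintype.subsetP => f fK.
suff : (f, true) \in [set x | x.1 \in edges K']%SET by rewrite inE.
apply: (connected_edge_connected Kc _ _ _ (fK : (f, true).1 \in _)) => [x _|v x y vK xv yv|].
- by rewrite !inE.
- rewrite !inE => xK'; apply: (vertex_edge _ yv).
  exact: component_vertex HK' (VH _ vK) xv xK'.
- by exists (e, true) => //; rewrite inE.
Qed.

(** The edges of one component form, inside another, a family that is closed
    under turning at vertices, and both have the vertices of the ambient graph. *)
Lemma component_unique H K K' e : is_component H K -> is_component H K' ->
  e \in edges K -> e \in edges K' -> K = K'.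
Proof.
move=> HK HK' eK eK'.
have EE : edges K = edges K'.
  apply/eqP; rewrite finset.eqEsubset (component_subset HK HK' eK eK').
  exact: component_subset HK' HK eK' eK.
apply: metric_graph_ext => //; apply/setP.
have sub L L' : is_component H L -> is_component H L' -> edges L = edges L' ->
    forall w, w \in vertices L -> w \in vertices L'.
  move=> HL HL' LL w wL; have [a aw] := vertex_neq0 wL.
  have [_ _ /fintype.subsetP VH _] := HL.
  by apply: (component_vertex HL' (VH _ wL) aw); rewrite -LL; exact: vertex_edge aw.
by move=> w; apply/idP/idP; apply: sub => //; exact/esym.
Qed.

Section ComponentOfEdge.
Variables (H : metric_graph len) (e : E).
Hypothesis eH : e \in edges H.

Let walk : rel (E * bool) := fun x y => (y == other_endpoint x) || same_vertex H x y.

Let walk_sym : symmetric walk.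
Proof.
move=> x y; rewrite /walk; congr (_ || _).
  by apply/eqP/eqP => ->; rewrite other_endpointK.
by apply/same_vertexP/same_vertexP => -[v [? ? ?]]; exists v.
Qed.

Let walk_edge x y : x.1 \in edges H -> walk x y -> y.1 \in edges H.
Proof.
move=> xH /orP[/eqP->//|/same_vertexP[v [vH _ yv]]]; exact: vertex_edge vH yv.
Qed.

Let F := [set f in edges H | connect walk (e, false) (f, false)]%SET.

Let inF x : (x.1 \in F) = (x.1 \in edges H) && connect walk (e, false) x.
Proof.
rewrite inE; congr andb; case: x => f [] //=.
apply/idP/idP => /connect_trans; apply; apply: connect1; rewrite /walk eqxx //.
Qed.

Let F_walk x y : x.1 \in F -> walk x y -> y.1 \in F.
Proof.
rewrite !inF => /andP[xH ex] xy; rewrite (walk_edge xH xy) /=.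
exact: connect_trans ex (connect1 xy).
Qed.

Let V := [set w in vertices H | [exists a in w, a.1 \in F]]%SET.

Let VP : finset.partition V [set a | a.1 \in F]%SET.
Proof.
have VH : V \subset vertices H by apply/fintype.subsetP => w; rewrite inE => /andP[].
have /and3P[_ tH nH] := verticesP H.
apply/and3P; split.
- apply/eqP/setP => a; rewrite inE; apply/bigcupP/idP => [[w]|aF].
    rewrite inE => /andP[wH /exists_inP[b bw bF]] aw.
    apply: F_walk bF _; rewrite /walk; apply/orP; right.
    by apply/same_vertexP; exists w.
  have /andP[aH _] : (a.1 \in edges H) && connect walk (e, false) a by rewrite -inF.
  have [w wH aw] := vertex_at aH; exists w => //.
  by rewrite inE wH; apply/exists_inP; exists a.
- exact: trivIsetS VH tH.
- by apply: contra nH; exact: (fintype.subsetP VH).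
Qed.

Lemma component_of_edge : exists2 K, is_component H K & e \in edges K.
Proof.
have eF : e \in F by rewrite inE eH connect0.
exists (@MetricGraph R E len F V VP) => //; split => /=.
- by apply/set0Pn; exists e.
- by apply/fintype.subsetP => f; rewrite inE => /andP[].
- by apply/fintype.subsetP => f; rewrite inE => /andP[].
- apply: edge_connected_connected => S Sother Svert [a /= aF aS] b /= bF.
  have ab : connect walk a b.
    move: aF bF; rewrite !inF => /andP[_ ea] /andP[_ eb].
    by apply: connect_trans eb; rewrite (sym_connect_sym walk_sym).
  case/connectP: ab => p pp ->; elim: p a aF aS pp => //= y p IHp a aF aS /andP[ay pp].
  apply: (IHp y) pp; first exact: F_walk aF ay.
  case/orP: ay => [/eqP->|/same_vertexP[v [vH av yv]]]; first exact: Sother.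
  apply: (Svert v a) => //; rewrite inE vH; apply/exists_inP; by exists a.
Qed.

End ComponentOfEdge.

Section Exhaustive.
Variables (G : metric_graph len) (k : nat) (P : 'I_k -> metric_graph len).
Hypothesis acyclic : ~ (exists c, is_cycle G c).
Hypothesis G_conn : edge_connected G.
Hypothesis k_ge2 : (2 <= k)%N.
Hypothesis P_inj : injective P.
Variable H : metric_graph len.
Hypothesis H_cut : is_cut G H.
Hypothesis H_components : forall K, is_component H K <-> exists i, K = P i.

Lemma cluster_component i : is_component H (P i).
Proof. by apply/H_components; exists i. Qed.

Lemma cut_refines : refines G H. Proof. exact: H_cut.2. Qed.

Lemma cluster_refines i : refines G (P i).
Proof.
move=> w wP; have [_ _ /fintype.subsetP VH _] := cluster_component i.
exact/cut_refines/VH.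
Qed.

Lemma cluster_of_edge e : e \in edges G -> exists i, e \in edges (P i).
Proof.
rewrite -H_cut.1 => /component_of_edge[K /H_components[i ->] eK]; by exists i.
Qed.

Lemma cluster_disjoint i j e : e \in edges (P i) -> e \in edges (P j) -> i = j.
Proof.
by move=> ei ej; apply: P_inj; exact: component_unique (cluster_component i) (cluster_component j) ei ej.
Qed.

Lemma cluster_edge_connected i : edge_connected (P i).
Proof. by have [_ _ _ /connected_edge_connected] := cluster_component i. Qed.

Lemma cluster_exit i v w : v \in vertices G -> w \in vertices (P i) -> w \proper v ->
  exists2 d, d \in v & d.1 \notin edges (P i).
Proof.
exact: dirichlet_vertex_exit acyclic (@cluster_refines i) (@cluster_edge_connected i).
Qed.

(** A cluster without Dirichlet vertex would be all of the connected graph, and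
    there would be no room for a second cluster. *)
Lemma cluster_dirichlet i :
  exists2 w, w \in vertices (P i) & w \in dirichlet_vertices G (P i).
Proof.
apply: contrapT => noD.
have uncut v a b : v \in vertices G -> a \in v -> b \in v ->
    a.1 \in edges (P i) -> b.1 \in edges (P i).
  move=> vG; apply: (uncut_vertex (@cluster_refines i) vG).
  rewrite inE vG; apply/negP => /exists_inP[w wP wv]; apply: noD; exists w => //.
  by rewrite inE wP; apply/exists_inP; exists v.
have [Pi0 _ _ _] := cluster_component i.
have all e : e \in edges G -> e \in edges (P i).
  move=> eG; suff : (e, true) \in [set x | x.1 \in edges (P i)]%SET by rewrite inE.
  apply: (G_conn _ _ _ (eG : (e, true).1 \in _)) => [x _|v x y vG xv yv|].
  - by rewrite !inE.
  - by rewrite !inE; exact: (uncut v).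
  - case/set0Pn: Pi0 => f fP; exists (f, true) => /=; last by rewrite inE.
    exact: refines_edge (@cluster_refines i) fP.
have [j ji] : exists j, j != i.
  have k0 : (0 < k)%N by exact: ltnW.
  have [ij|] := eqVneq i (Ordinal k0); last by move=> ?; exists (Ordinal k0); rewrite eq_sym.
  by exists (Ordinal k_ge2); rewrite ij.
have [/set0Pn[f fP] _ _ _] := cluster_component j.
move/eqP: ji; apply; apply: (cluster_disjoint fP).
by apply: all; exact: refines_edge (@cluster_refines j) fP.
Qed.

Definition is_cut_vertex v := [exists i, exists w in vertices (P i), w \proper v].

Lemma uncut_vertex_cluster v a i : v \in vertices G -> ~~ is_cut_vertex v ->
  a \in v -> a.1 \in edges (P i) -> v \in vertices (P i).
Proof.
move=> vG vcut av aP; have [w wP aw] := vertex_at aP.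
have [u uG wu] := cluster_refines wP.
have uv : u = v by apply: (vertex_inj uG vG _ av); exact: (fintype.subsetP wu).
rewrite uv in wu; suff <- : w = v by [].
apply/eqP; apply: contraNT vcut => wv; apply/existsP; exists i.
by apply/exists_inP; exists w => //; rewrite finset.properEneq wv.
Qed.

Lemma cut_vertex_cluster v w j : v \in vertices G -> is_cut_vertex v ->
  w \in vertices (P j) -> w \subset v -> w \proper v.
Proof.
move=> vG /existsP[i /exists_inP[w' w'P w'v]] wP wv.
rewrite finset.properEneq wv andbT; apply/eqP => wE; subst w.
have [a aw'] := vertex_neq0 w'P.
have /fintype.subsetP/(_ _ aw') av := proper_sub w'v.
have ij : i = j.
  exact: cluster_disjoint (vertex_edge w'P aw') (vertex_edge wP av).
subst j; have E' := vertex_inj w'P wP aw' av.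
by move: w'v; rewrite E' finset.properEneq eqxx.
Qed.

Hypothesis P_interiors : has_connected_interiors G P.

Lemma cut_vertex_leaf v w j a b : v \in vertices G -> is_cut_vertex v ->
  w \in vertices (P j) -> a \in w -> b \in w -> a \in v -> a = b.
Proof.
move=> vG vcut wP aw bw av.
have [u uG wu] := cluster_refines wP.
have uv : u = v by apply: (vertex_inj uG vG _ av); exact: (fintype.subsetP wu).
rewrite uv in wu.
apply: (dirichlet_vertex_leaf (@cluster_refines j) acyclic (@cluster_exit j) _ vG wP _ aw bw).
  exact: P_interiors.
exact: cut_vertex_cluster vcut wP wu.
Qed.

(** Rigidity comes for free in a tree: the cut vertices of a cluster are boundary
    points because [dirichlet_vertex_exit] provides an edge leaving the
    cluster. *)
Lemma boundary_cut_set : is_rigid G P.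
Proof.
apply/seteqP; split=> p.
  move=> [v [vG pv [i [w wP wv]]]]; exists i => //.
  apply/(boundaryP (@cluster_refines i) p (@cluster_exit i)).
  by exists v => //; rewrite inE vG; apply/exists_inP; exists w.
move=> [i _ /(boundaryP (@cluster_refines i) p (@cluster_exit i))[v vc pv]].
move: vc; rewrite inE => /andP[vG /exists_inP[w wP wv]].
by exists v; split=> //; exists i; exists w.
Qed.

End Exhaustive.
End Components.

(** * The first degeneracy of a family of quadratic forms *)

Section LinkForm.
Context {R : realType} {T J : finType}.
Variables (A : {set T}) (L : {set J}) (s t : J -> T) (w c : J -> R -> R).
Implicit Types (X Y : T -> R) (k : R).

(** The index set [L] is a set of links between nodes; the form is minus the
    energy of a network in which each link contributes a multiple of
    [c X_s^2 - 2 X_s X_t + c X_t^2].  Off-diagonal coefficients are positive. *)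
Definition link_bilin k X Y : R :=
  \sum_(j in L) w j k * (X (s j) * Y (t j) + X (t j) * Y (s j)
     - c j k * (X (s j) * Y (s j) + X (t j) * Y (t j))).

Definition link_form k X : R := link_bilin k X X.

Definition supported X := forall i, i \notin A -> X i = 0.

Lemma link_formD k X Y r :
  link_form k (fun i => X i + r * Y i) =
  link_form k X + 2 * r * link_bilin k X Y + r ^+ 2 * link_form k Y.
Proof.
rewrite /link_form /link_bilin !mulr_sumr -!big_split /=.
by apply: eq_bigr => j _; ring.
Qed.

Lemma link_formZ k X r : link_form k (fun i => r * X i) = r ^+ 2 * link_form k X.
Proof.
by rewrite /link_form /link_bilin mulr_sumr; apply: eq_bigr => j _; ring.
Qed.

Variable k1 : R.
Hypothesis w_gt0 : forall j k, j \in L -> 0 <= k <= k1 -> 0 < w j k.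
Hypothesis w_cont : forall j k, j \in L -> 0 <= k <= k1 -> {for k, continuous (w j)}.
Hypothesis c_cont : forall j k, j \in L -> 0 <= k <= k1 -> {for k, continuous (c j)}.

Lemma link_form_norm k X : 0 <= k <= k1 ->
  link_form k X <= link_form k (fun i => `|X i|).
Proof.
move=> kk; apply: ler_sum => j jL; rewrite ler_wpM2l ?(ltW (w_gt0 jL kk)) //.
rewrite -!normrM -!expr2 ![`| _ ^+ 2|]ger0_norm ?sqr_ge0 //.
by rewrite lerD2r lerD // ler_norm.
Qed.

(* A frequency and a vector are packed into one function on [option T], so that
   compactness follows from the theorem of Tychonoff. *)
Let Z := prod_topology (fun _ : option T => R).

Let coordZ i (z : Z) : {for z, continuous (fun u : Z => (u i : R))}.
Proof. exact: (@proj_continuous _ (fun _ : option T => R) i z). Qed.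

Let sum_contZ (I : finType) (P : {set I}) (f : I -> Z -> R) (z : Z) :
  (forall i, i \in P -> {for z, continuous (f i)}) ->
  {for z, continuous (fun u => \sum_(i in P) f i u)}.
Proof.
move=> fc; have -> : (fun u => \sum_(i in P) f i u) = \sum_(i in P) f i.
  by apply/funext => u; rewrite fct_sumE.
elim/big_ind : _ => [|g h gc hc|i iP]; [exact: cst_continuous| |exact: (fc i iP)].
exact: (continuousD gc hc).
Qed.

Let link_form_contZ (z : Z) : 0 <= z None <= k1 ->
  {for z, continuous (fun u : Z => link_form (u None) (fun i => u (Some i)))}.
Proof.
move=> zk; apply: sum_contZ => j jL.
have wc : {for z, continuous (fun u : Z => w j (u None))}.
  by apply: continuous_comp; [exact: coordZ|exact: (w_cont jL)].
have cc : {for z, continuous (fun u : Z => c j (u None))}.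
  by apply: continuous_comp; [exact: coordZ|exact: (c_cont jL)].
have XX i i' : {for z, continuous (fun u : Z => u (Some i) * u (Some i'))}.
  exact: (continuousM (@coordZ (Some i) z) (@coordZ (Some i') z)).
exact: (continuousM wc (continuousB (continuousD (XX _ _) (XX _ _))
  (continuousM cc (continuousD (XX _ _) (XX _ _))))).
Qed.

Let link_form_contR X k : 0 <= k <= k1 ->
  {for k, continuous (fun k' => link_form k' X)}.
Proof.
move=> kk; rewrite /link_form /link_bilin.
have -> : (fun k' => \sum_(j in L) w j k' * (X (s j) * X (t j) + X (t j) * X (s j)
     - c j k' * (X (s j) * X (s j) + X (t j) * X (t j)))) =
  \sum_(j in L) (fun k' => w j k' * (X (s j) * X (t j) + X (t j) * X (s j)
     - c j k' * (X (s j) * X (s j) + X (t j) * X (t j)))).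
  by apply/funext => u; rewrite fct_sumE.
elim/big_ind : _ => [|g h gc hc|j jL]; [exact: cst_continuous|exact: (continuousD gc hc)|].
apply: continuousM; first exact: (w_cont jL kk).
apply: cvgB; first exact: cst_continuous.
by apply: cvgM; [exact: (c_cont jL kk)|exact: cst_continuous].
Qed.

Let closed_fun_eq (f : Z -> R) a : continuous f -> closed [set z | f z = a].
Proof.
move=> fc; apply: (@closed_comp _ _ f [set x | x = a]) => [z _|]; first exact: fc.
exact: closed_eq.
Qed.

(** The pairs of a parameter [k] and a vector of the simplex on which the form is
    nonnegative are a compact set, since nonnegative vectors suffice
    ([link_form_norm]); a pair with the least [k] is taken.  The form is then
    nonpositive at this [k] by continuity from below, so that the vector is a
    maximum, hence a stationary point. *)
Lemma first_critical_value X1 :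
  0 < k1 ->
  (forall X, supported X -> 0 <= link_form 0 X -> forall i, X i = 0) ->
  supported X1 -> 0 <= link_form k1 X1 -> (exists i, X1 i != 0) ->
  exists k0 X0,
  [/\ 0 < k0 <= k1, supported X0 /\ (forall i, 0 <= X0 i), (exists i, X0 i != 0),
      (forall Y, supported Y -> link_bilin k0 X0 Y = 0) &
      forall k X, 0 <= k < k0 -> supported X -> 0 <= link_form k X ->
        forall i, X i = 0].
Proof.
move=> k1_gt0 form0 X1s X1f [i1 X1i1].
pose B : set Z := [set z | forall i,
  (if i is Some _ then `[0, 1]%classic else `[0, k1]%classic) (z i)].
have Bc : compact B.
  apply: (@tychonoff _ (fun _ : option T => R)
    (fun i => if i is Some _ then `[0, 1]%classic else `[0, k1]%classic)).
  by case=> *; exact: segment_compact.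
have Bcl : closed B.
  have hZ : hausdorff_space Z by apply: hausdorff_product => i; exact: Rhausdorff.
  exact: compact_closed hZ Bc.
pose C : set Z := B `&` [set z | \sum_(i in [set: T]%SET) z (Some i) = 1] `&`
  [set z | forall i, i \notin A -> z (Some i) = 0] `&`
  [set z | 0 <= link_form (z None) (fun i => z (Some i))].
have Bk (z : Z) : B z -> 0 <= z None <= k1 by move=> /(_ None); rewrite /= in_itv.
have Ccl : closed C.
  move=> z zC.
  have sub (D : set Z) : C `<=` D -> closed D -> D z.
    by move=> CD; apply; apply: closure_subset zC.
  have Bz : B z by apply: sub Bcl => ? [[[]]].
  split; first split; first split => //.
  - apply: (@sub [set z | \sum_(i in [set: T]%SET) z (Some i) = 1]) => [? [[[]]]//|].
    apply: closed_fun_eq => u.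
    by apply: (@sum_contZ _ _ (fun i (v : Z) => v (Some i)) u) => i _; exact: coordZ.
  - move=> i iA; apply: (@sub [set z | z (Some i) = 0]) => [? [[[_ _]]] + _|].
      exact.
    by apply: closed_fun_eq => u; exact: coordZ.
  - rewrite /= leNgt; apply/negP => zlt.
    have N : nbhs (link_form (z None) (fun i => z (Some i))) [set x | x < 0].
      by apply: open_nbhs_nbhs; split; [exact: open_lt|].
    have [y [Cy]] := zC _ (link_form_contZ (Bk _ Bz) N).
    by rewrite /= ltNge; case: Cy => _ ->.
have Cc : compact C by apply: (subclosed_compact Ccl Bc) => ? [[[]]].
(* Any vector on which the form is nonnegative is normalized into the simplex
   after taking absolute values. *)
have norm_in_C k X : 0 <= k <= k1 -> supported X -> 0 <= link_form k X ->
    (exists i, X i != 0) -> exists2 z, C z & z None = k.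
  move=> kk Xs Xf [i Xi]; pose N := \sum_i `|X i|.
  have N0 : 0 < N.
    rewrite /N (bigD1 i) //= ltr_pwDl ?normr_gt0 //; exact: sumr_ge0.
  exists (fun o => if o is Some i then `|X i| / N else k) => //.
  split; first split; first split.
  - move=> [j|] /=; rewrite in_itv /=; last by [].
    rewrite divr_ge0 ?(ltW N0) //= ler_pdivrMr // mul1r /N (bigD1 j) //= lerDl.
    exact: sumr_ge0.
  - rewrite /= -mulr_suml (_ : \sum_(i in _) _ = N) ?divff ?gt_eqF //.
    by apply: eq_bigl => j; rewrite inE.
  - by move=> j jA /=; rewrite Xs // normr0 mul0r.
  - rewrite /=.
    have -> : (fun i => `|X i| / N) = (fun i => N^-1 * `|X i|).
      by apply/funext => j; rewrite mulrC.
    rewrite link_formZ mulr_ge0 ?sqr_ge0 //; exact: le_trans Xf (link_form_norm _ kk).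
have k11 : 0 <= k1 <= k1 by rewrite (ltW k1_gt0) lexx.
have [z1 Cz1 z1k] := norm_in_C _ _ k11 X1s X1f (ex_intro _ i1 X1i1).
have [||z /set_mem Cz zmin] := @compact_EVT_min _ _ (fun u : Z => u None) C _ Cc.
  by exists z1.
  by apply: continuous_subspaceT => u; exact: coordZ.
have below k X : 0 <= k < z None -> supported X -> 0 <= link_form k X ->
    forall i, X i = 0.
  move=> /andP[k0 kz] Xs Xf i; apply/eqP/negP => /negP Xi.
  have kk : 0 <= k <= k1.
    by rewrite k0 (le_trans (ltW kz)) //; case: Cz => -[[/Bk/andP[]]].
  have [u Cu uk] := norm_in_C _ _ kk Xs Xf (ex_intro _ i Xi).
  by have := zmin _ (mem_set Cu); rewrite uk leNgt kz.
case: (Cz) => -[[Bz zsum] zsupp] zform.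
have /andP[zN0 zN1] := Bk _ Bz.
have zne0 : exists i, z (Some i) != 0.
  apply: contrapT => z0; move: zsum => /=; rewrite big1 => [/esym/eqP|i _].
    by rewrite oner_eq0.
  by apply/eqP/negPn/negP => zi; apply: z0; exists i.
have zN_gt0 : 0 < z None.
  rewrite lt_neqAle zN0 andbT; apply/eqP => z0.
  have [i /negP] := zne0; apply; apply/eqP.
  by apply: (form0 (fun i => z (Some i))) => //; move: zform => /=; rewrite -z0.
exists (z None), (fun i => z (Some i)); split => //.
- by rewrite zN_gt0.
- split=> // i.
  by have := Bz (Some i); rewrite /= in_itv /= => /andP[].
have kk : 0 <= z None <= k1 by rewrite zN0.
(* A positive value would persist at slightly smaller parameters. *)
have formle0 X : supported X -> link_form (z None) X <= 0.
  move=> Xs; rewrite leNgt; apply/negP => fpos.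
  have N : nbhs (link_form (z None) X) [set x | 0 < x].
    by apply: open_nbhs_nbhs; split; [exact: open_gt|].
  have /nbhs_ballP[e /= e0 eb] := @link_form_contR X _ kk _ N.
  pose k := Num.max (z None / 2) (z None - e / 2).
  have kz : 0 <= k < z None.
    rewrite le_max divr_ge0 ?(ltW zN_gt0) //= gt_max ltr_pdivrMr // mulr2n mulrDr.
    by rewrite mulr1 ltrDl zN_gt0 ltrBlDr ltrDl divr_gt0.
  have fk : 0 < link_form k X.
    apply: eb; rewrite /ball /= distrC ltr_distlC.
    have k1' : z None - e / 2 <= k by rewrite /k le_max lexx orbT.
    case/andP: kz => _ kz; lra.
  have X0 := below _ _ kz Xs (ltW fk).
  move: fk; rewrite /link_form /link_bilin big1 ?ltxx // => j _.
  by rewrite !X0 !(mulr0, mul0r, addr0, subr0).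
have zX0 : link_form (z None) (fun i => z (Some i)) = 0.
  by apply/eqP; rewrite eq_le formle0 //=; case: Cz.
(* Both terms of the expansion in the direction [Y] are controlled: were the
   linear one nonzero, the step [b / (1 - q)] would make the form positive. *)
move=> Y Ys; set b := link_bilin _ _ _; set q := link_form (z None) Y.
have pert r : 2 * r * b + r ^+ 2 * q <= 0.
  have := formle0 (fun i => z (Some i) + r * Y i).
  rewrite link_formD zX0 add0r; apply=> i iA.
  by rewrite zsupp // Ys // mulr0 addr0.
have q0 : q <= 0 by exact: formle0.
apply/eqP/negPn/negP => b0.
have := pert (b / (1 - q)).
have q1 : 0 < 1 - q by lra.
have -> : 2 * (b / (1 - q)) * b + (b / (1 - q)) ^+ 2 * q =
   b ^+ 2 * (2 - q) / (1 - q) ^+ 2.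
  by field; rewrite gt_eqF.
rewrite leNgt; case/negP.
rewrite divr_gt0 ?exprn_gt0 // mulr_gt0 //; last by lra.
by rewrite exprn_even_gt0.
Qed.
End LinkForm.

(** * The equation f'' = - mu f on an interval *)

Section Helmholtz.
Context {R : realType}.
Implicit Types (f df g : R -> R) (l mu kap : R).

Lemma constant_of_derive0 l g :
  {within `[0, l], continuous g} ->
  (forall x, 0 < x < l -> is_derive x 1 g 0) ->
  forall x y, 0 <= x <= l -> 0 <= y <= l -> g x = g y.
Proof.
move=> gc gd; wlog xy : / forall x y, 0 <= x -> x <= y -> y <= l -> g x = g y.
  apply=> x y x0 xy yl.
  have [||z _ ] := @MVT_segment R g (fun=> 0) x y xy.
  - move=> z; rewrite in_itv /= => /andP[xz zy]; apply: gd.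
    by rewrite (le_lt_trans x0) //= (lt_le_trans zy).
  - apply: continuous_subspaceW gc => z /=; rewrite !in_itv /= => /andP[xz zy].
    by rewrite (le_trans x0) //= (le_trans zy).
  by rewrite mul0r => /eqP; rewrite subr_eq0 => /eqP.
move=> x y /andP[x0 xl] /andP[y0 yl].
by case: (leP x y) => [|/ltW] le; [apply: xy|apply/esym/xy].
Qed.

Section Solution.
Variables (l mu : R) (f df : R -> R).
Hypothesis f_cont : {within `[0, l], continuous f}.
Hypothesis df_cont : {within `[0, l], continuous df}.
Hypothesis f_der : forall x, 0 < x < l -> is_derive x 1 f (df x).
Hypothesis df_der : forall x, 0 < x < l -> is_derive x 1 df (- (mu * f x)).

(** Rotating the pair of [kap * f] and [df] backwards by the angle
    [kap * (x - h)] gives a constant pair, here [u] and [v]. *)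
Lemma helmholtz_solution kap h x : mu = kap ^+ 2 -> kap != 0 ->
  0 <= h <= l -> 0 <= x <= l ->
  f x = f h * cos (kap * (x - h)) + df h / kap * sin (kap * (x - h)) /\
  df x = df h * cos (kap * (x - h)) - kap * f h * sin (kap * (x - h)).
Proof.
move=> mukap kap0 hl xl.
pose C y := cos (kap * (y - h)); pose S y := sin (kap * (y - h)).
have dC (y : R) : is_derive y 1 C (- kap * S y).
  rewrite /C; apply: is_derive_eq; rewrite /S /GRing.scale /=; ring.
have dS (y : R) : is_derive y 1 S (kap * C y).
  rewrite /S; apply: is_derive_eq; rewrite /C /GRing.scale /=; ring.
have cC : {within `[0, l], continuous C}.
  apply: derivable_within_continuous => y _; by have := dC y.
have cS : {within `[0, l], continuous S}.
  apply: derivable_within_continuous => y _; by have := dS y.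
pose u y := kap * (f y * C y) - df y * S y.
pose v y := kap * (f y * S y) + df y * C y.
have uc : u x = u h.
  apply: (@constant_of_derive0 l) => // [y|y yl].
    apply: cvgB; last by apply: cvgM; [exact: df_cont|exact: cS].
    apply: cvgM; first exact: cst_continuous.
    by apply: cvgM; [exact: f_cont|exact: cC].
  have := f_der yl; have := df_der yl; have := dC y; have := dS y => ? ? ? ?.
  rewrite /u; apply: is_derive_eq; rewrite /GRing.scale /= mukap; ring.
have vc : v x = v h.
  apply: (@constant_of_derive0 l) => // [y|y yl].
    apply: cvgD; last by apply: cvgM; [exact: df_cont|exact: cC].
    apply: cvgM; first exact: cst_continuous.
    by apply: cvgM; [exact: f_cont|exact: cS].
  have := f_der yl; have := df_der yl; have := dC y; have := dS y => ? ? ? ?.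
  rewrite /v; apply: is_derive_eq; rewrite /GRing.scale /= mukap; ring.
have CSh : C h = 1 /\ S h = 0 by rewrite /C /S subrr mulr0 cos0 sin0.
move: uc vc; rewrite {2}/u {2}/v; case: CSh => -> ->; rewrite !mulr0 mulr1 add0r subr0 mulr1 => uc vc.
have cs : C x ^+ 2 + S x ^+ 2 = 1 by exact: cos2Dsin2.
rewrite -/(C x) -/(S x); split.
  apply: (mulfI kap0); rewrite mulrDr mulrA -uc mulrA [kap * (_ / _)]mulrC divfK // -vc /u /v.
  rewrite -[LHS]mulr1 -cs; ring.
rewrite -uc -vc /u /v -[LHS]mulr1 -cs; ring.
Qed.

(** For a nonpositive parameter, the derivative [f'^2 - mu f^2] of [f f'] is
    nonnegative. *)
Lemma nonpos_energy : mu <= 0 -> 0 < l ->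
  f 0 * df 0 <= f l * df l /\
  (f 0 * df 0 = f l * df l ->
   forall x y, 0 <= x <= l -> 0 <= y <= l -> f x = f y).
Proof.
move=> mu0 l0; pose g y := f y * df y.
have gc : {within `[0, l], continuous g}.
  by move=> y; apply: cvgM; [exact: f_cont|exact: df_cont].
have gd y : 0 < y < l -> is_derive y 1 g (df y ^+ 2 - mu * f y ^+ 2).
  move=> yl; have := f_der yl; have := df_der yl => ? ?.
  by rewrite /g; apply: is_derive_eq; rewrite /GRing.scale /=; ring.
have gd0 y : 0 <= df y ^+ 2 - mu * f y ^+ 2.
  by rewrite subr_ge0 (le_trans (y := 0)) ?sqr_ge0 // mulr_le0_ge0 ?sqr_ge0.
have mono : {in `[0, l]%R &, {homo g : x y / x <= y}}.
  apply: ger0_derive1_le_cc gc => x; rewrite in_itv /= => xl; have := gd _ xl => ? //.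
  by rewrite derive1E derive_val.
have in0 : 0 \in `[0, l]%R by rewrite in_itv /= lexx ltW.
have inl : l \in `[0, l]%R by rewrite in_itv /= lexx ltW.
split=> [|gE]; first by apply: mono => //; exact: ltW.
have gK y : 0 <= y <= l -> g y = g 0.
  move=> yl; have yin : y \in `[0, l]%R by rewrite in_itv.
  case/andP: yl => y0 yl; apply/eqP; rewrite eq_le.
  by rewrite (mono 0 y) // andbT [g 0]gE (mono y l).
apply: (constant_of_derive0 f_cont) => y yl.
suff df0 : df y = 0 by have := f_der yl; rewrite df0.
have g0 : is_derive y 1 g 0.
  apply: (derive1_at_max (ltW l0)) => [z|//|z]; rewrite in_itv /= => zl.
    by have := gd _ zl.
  by case/andP: zl => z0 zl; case/andP: yl => y0 yl; rewrite !gK // ?(ltW z0) ?(ltW zl) ?(ltW y0) ?(ltW yl).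
have := gd _ yl => gd'.
have : df y ^+ 2 - mu * f y ^+ 2 = 0.
  by rewrite -(@derive_val _ _ _ _ _ _ _ gd') (@derive_val _ _ _ _ _ _ _ g0).
move=> dE; have : df y ^+ 2 <= 0.
  by rewrite -dE lerDl oppr_ge0 mulr_le0_ge0 ?sqr_ge0.
by rewrite le_eqVlt ltNge sqr_ge0 orbF sqrf_eq0 => /eqP.
Qed.
End Solution.
End Helmholtz.

(** * Continuity of the half-edge weights *)

Section Sinc.
Context {R : realType}.
Implicit Types (h k : R).

(** The value at [h] of the solution of [f'' = - k^2 f] with [f 0 = 0] and
    [f' 0 = 1]; as a function of [k] it is continuous at zero. *)
Definition sinc_len h k : R := if k == 0 then h else sin (k * h) / k.

Lemma sinc_len_cont h k : {for k, continuous (sinc_len h)}.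
Proof.
have sd (x : R) : is_derive x 1 (fun x => sin (x * h)) (h * cos (x * h)).
  by apply: is_derive_eq; rewrite /GRing.scale /=; ring.
have [->|k0] := eqVneq k 0.
  apply/continuous_withinNx.
  have -> : sinc_len h 0 = 'D_1 (fun x : R => sin (x * h)) 0.
    by rewrite (@derive_val _ _ _ _ _ _ _ (sd 0)) mul0r cos0 mulr1 /sinc_len eqxx.
  have : derivable (fun x : R => sin (x * h)) 0 1 by have := sd 0.
  apply: cvg_trans; apply: near_eq_cvg; near=> x.
  have x0 : x != 0 by near: x; exact: nbhs_dnbhs_neq.
  by rewrite /sinc_len (negbTE x0) /= /GRing.scale /= mul0r sin0 subr0 mulr1 addr0 mulrC.
have c : {for k, continuous (fun x : R => sin (x * h) / x)}.
  apply: cvgM; last exact: cvgV.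
  by have /derivable1_diffP/differentiable_continuous := @ex_derive _ _ _ _ _ _ _ (sd k).
rewrite /prop_for /continuous_at {2}/sinc_len (negbTE k0).
refine (cvg_trans _ c); apply: near_eq_cvg; near=> x.
have x0 : x != 0 by near: x; exact: open_nbhs_nbhs (conj (@open_neq _ _) k0).
by rewrite /sinc_len (negbTE x0).
Unshelve. all: end_near. Qed.

Lemma sinc_len_gt0 h k : 0 < h -> 0 <= k -> k * h < pi -> 0 < sinc_len h k.
Proof.
move=> h0 k0 kh; rewrite /sinc_len; case: eqVneq => [//|kn0].
have kp : 0 < k by rewrite lt_neqAle eq_sym kn0.
by rewrite divr_gt0 // sin_gt0_pi // mulr_gt0.
Qed.
End Sinc.

(** * The positive ground state of a cluster *)

Section Eigenpair.
Context {R : realType} {E : finType} {len : E -> {posnum R}}.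

(** The derivative is an argument, unlike in [is_eigenfunction], because gluing
    needs the slopes at the Dirichlet vertices. *)
Definition is_eigenpair (K : metric_graph len) (D : {set {set E * bool}}) (mu : R)
    (psi dpsi : E -> R -> R) : Prop :=
  [/\ forall e, e \in edges K ->
        {within `[0, (len e)%:num], continuous (psi e)} /\
        {within `[0, (len e)%:num], continuous (dpsi e)},
      forall e x, e \in edges K -> 0 < x < (len e)%:num ->
        is_derive x 1 (psi e) (dpsi e x) /\
        is_derive x 1 (dpsi e) (- (mu * psi e x)),
      forall v a b, v \in vertices K -> a \in v -> b \in v ->
        @endpoint_value R E len psi a = @endpoint_value R E len psi b,
      forall v a, v \in vertices K -> v \in D -> a \in v ->
        @endpoint_value R E len psi a = 0 &
      forall v, v \in vertices K -> v \notin D ->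
        \sum_(a in v) @inward_derivative R E len dpsi a = 0].
End Eigenpair.

Section GroundState.
Context {R : realType} {E : finType} {len : E -> {posnum R}}.
Variables (K : metric_graph len) (D : {set {set E * bool}}).
Implicit Types (a b : E * bool) (e : E) (v : {set E * bool}) (k : R).

Definition half_len e : R := (len e)%:num / 2.

Local Notation node := ({set E * bool} + E)%type.

Definition vertex_node a : node := inl (finset.pblock (vertices K) a).
Definition midpoint_node a : node := inr a.1.
Definition free_nodes : {set node} :=
  [set n : node | match n with
    | inl v => (v \in vertices K) && (v \notin D)
    | inr e => e \in edges K end]%SET.
Definition endpoints : {set E * bool} := [set a | a.1 \in edges K]%SET.
Definition half_weight a k : R := (sinc_len (half_len a.1) k)^-1.
Definition half_cos a k : R := cos (k * half_len a.1).

Local Notation bilin := (link_bilin endpoints vertex_node midpoint_node half_weight half_cos).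
Local Notation form := (link_form endpoints vertex_node midpoint_node half_weight half_cos).

Lemma len_gt0 e : 0 < (len e)%:num. Proof. by []. Qed.

Lemma half_len_gt0 e : 0 < half_len e. Proof. by rewrite divr_gt0. Qed.

Lemma half_lenD e : half_len e + half_len e = (len e)%:num.
Proof. by rewrite /half_len -splitr. Qed.

Lemma half_weightE a k : k != 0 ->
  half_weight a k = k / sin (k * half_len a.1).
Proof. by move=> k0; rewrite /half_weight /sinc_len (negbTE k0) invf_div. Qed.

Lemma vertex_nodeE v a : v \in vertices K -> a \in v -> vertex_node a = inl v.
Proof. by move=> vK av; rewrite /vertex_node (pblock_vertex vK av). Qed.

(** Testing the form at a midpoint gives the condition that the derivative is
    continuous there; testing it at a vertex gives the Kirchhoff condition. *)
Lemma bilin_midpoint k (X : node -> R) e : e \in edges K ->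
  bilin k X (fun n => (n == inr e)%:R) =
  \sum_(c : bool) half_weight (e, c) k *
    (X (vertex_node (e, c)) - half_cos (e, c) k * X (inr e)).
Proof.
move=> eK; rewrite /link_bilin sum_over_edges (bigD1 e) //= [X in _ + X]big1 => [|e' /andP[_ ne]].
  rewrite addr0 big_bool addrC /vertex_node /midpoint_node /= eqxx.
  by rewrite !(mulr1, mulr0, addr0, add0r).
have ne' : (inr e' == inr e :> node) = false by apply/negbTE.
by rewrite /vertex_node /midpoint_node /= ne' !(mulr0, addr0, subr0).
Qed.

Lemma bilin_vertex k (X : node -> R) v : v \in vertices K ->
  bilin k X (fun n => (n == inl v)%:R) =
  \sum_(a in v) half_weight a k * (X (inr a.1) - half_cos a k * X (inl v)).
Proof.
move=> vK; rewrite /link_bilin sum_over_vertices (bigD1 v) //= [X in _ + X]big1 => [|v' /andP[v'K ne]].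
  rewrite addr0; apply: eq_bigr => a av; rewrite (vertex_nodeE vK av) /midpoint_node /= eqxx.
  by rewrite !(mulr1, mulr0, addr0, add0r).
rewrite big1 // => a av; rewrite (vertex_nodeE v'K av) /midpoint_node /=.
have -> : (inl v' == inl v :> node) = false by apply/negbTE.
by rewrite !(mulr0, addr0, subr0).
Qed.

Section LongestEdge.
Variable e0 : E.
Hypothesis e0K : e0 \in edges K.
Hypothesis e0_max : forall e, e \in edges K -> (len e)%:num <= (len e0)%:num.

(** At this frequency the longest edge is half a wavelength long. *)
Definition kmax : R := pi / (len e0)%:num.

Lemma kmax_gt0 : 0 < kmax. Proof. by rewrite divr_gt0 ?pi_gt0. Qed.

Lemma half_angle e k : e \in edges K -> 0 <= k <= kmax ->
  0 <= k * half_len e <= pi / 2.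
Proof.
move=> eK /andP[k0 kk]; rewrite mulr_ge0 ?(ltW (half_len_gt0 _)) //=.
rewrite /half_len mulrA ler_wpM2r ?invr_ge0 //.
apply: le_trans (ler_wpM2l k0 (e0_max eK)) _.
by rewrite -ler_pdivlMr.
Qed.

Lemma half_angle_lt_pi e k : e \in edges K -> 0 <= k <= kmax ->
  k * half_len e < pi.
Proof.
move=> eK kk; have /andP[_ /le_lt_trans->//] := half_angle eK kk.
by have := pi_gt0 R; lra.
Qed.

Lemma half_weight_gt0 a k : a \in endpoints -> 0 <= k <= kmax ->
  0 < half_weight a k.
Proof.
rewrite inE => aK kk; rewrite invr_gt0 sinc_len_gt0 ?half_len_gt0 ?half_angle_lt_pi //.
by case/andP: kk.
Qed.

Lemma half_weight_cont a k : a \in endpoints -> 0 <= k <= kmax ->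
  {for k, continuous (half_weight a)}.
Proof.
move=> aK kk; apply: cvgV; last exact: sinc_len_cont.
by rewrite gt_eqF // -invr_gt0 half_weight_gt0.
Qed.

Lemma half_cos_cont a k : a \in endpoints -> 0 <= k <= kmax ->
  {for k, continuous (half_cos a)}.
Proof.
move=> _ _; apply: continuous_comp; last exact: continuous_cos.
by apply: cvgM; [exact: cvg_id|exact: cvg_cst].
Qed.

Hypothesis K_conn : edge_connected K.
Hypothesis D_vertex : exists2 v, v \in vertices K & v \in D.

(** At frequency zero the form is minus a sum of squares of differences along
    the half edges, so a vector in its kernel is constant, and it vanishes at a
    Dirichlet vertex. *)
Lemma form0_definite (X : node -> R) :
  supported free_nodes X -> 0 <= form 0 X -> forall n, X n = 0.
Proof.
move=> Xs X0.
have k00 : (0 : R) <= 0 <= kmax by rewrite lexx (ltW kmax_gt0).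
have sq : form 0 X = - \sum_(a in endpoints) half_weight a 0 *
    (X (vertex_node a) - X (midpoint_node a)) ^+ 2.
  rewrite /link_form /link_bilin -sumrN; apply: eq_bigr => a _.
  by rewrite /half_cos mul0r cos0; ring.
have tm a : a \in endpoints -> 0 <= half_weight a 0 *
    (X (vertex_node a) - X (midpoint_node a)) ^+ 2.
  by move=> aK; rewrite mulr_ge0 ?sqr_ge0 // ltW // half_weight_gt0.
have eqX a : a.1 \in edges K -> X (vertex_node a) = X (inr a.1).
  move=> aK; have aE : a \in endpoints by rewrite inE.
  have s0 : \sum_(a in endpoints) half_weight a 0 *
    (X (vertex_node a) - X (midpoint_node a)) ^+ 2 = 0.
    by apply/eqP; rewrite eq_le sumr_ge0 // andbT -oppr_ge0 -sq.
  move/eqP: s0; rewrite psumr_eq0 // => /allP/(_ a (mem_index_enum _)).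
  rewrite aE /= mulf_eq0 gt_eqF ?half_weight_gt0 //= sqrf_eq0 subr_eq0.
  by move/eqP.
have all0 b : b.1 \in edges K -> X (inr b.1) = 0.
  move=> bK; suff : b \in [set b | X (inr b.1) == 0]%SET by rewrite inE => /eqP.
  apply: K_conn bK => [a _|v a c vK av cv|].
  - by rewrite !inE.
  - rewrite !inE -!eqX ?(vertex_edge vK) //.
    by rewrite (vertex_nodeE vK av) (vertex_nodeE vK cv).
  - have [v vK vD] := D_vertex; have [a av] := vertex_neq0 vK.
    exists a; first exact: vertex_edge av.
    rewrite inE -eqX ?(vertex_edge vK) // (vertex_nodeE vK av) Xs //.
    by rewrite inE vK vD.
move=> n; case: (boolP (n \in free_nodes)) => [|/Xs//].
case: n => [v|e]; rewrite inE; last by move=> eK; exact: (all0 (e, true)).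
case/andP=> vK _; have [a av] := vertex_neq0 vK.
by rewrite -(vertex_nodeE vK av) eqX ?all0 ?(vertex_edge vK).
Qed.

Lemma critical_frequency : exists k (X : node -> R),
  [/\ 0 < k <= kmax, supported free_nodes X /\ (forall n, 0 <= X n),
      (exists n, X n != 0),
      (forall Y, supported free_nodes Y -> bilin k X Y = 0) &
      forall k' Y, 0 <= k' < k -> supported free_nodes Y -> 0 <= form k' Y ->
        forall n, Y n = 0].
Proof.
apply: (first_critical_value half_weight_gt0 half_weight_cont half_cos_cont
  (X1 := fun n => (n == inr e0)%:R) kmax_gt0 form0_definite).
- move=> n nf; case: eqP => // ne; move: nf; rewrite ne inE e0K //.
- rewrite /link_form bilin_midpoint // big_bool /vertex_node /half_cos /=.
  rewrite !eqxx /kmax /half_len mulrA divfK ?gt_eqF //.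
  by rewrite cos_pihalf !mul0r subr0 !mulr0 addr0.
- by exists (inr e0); rewrite eqxx oner_neq0.
Qed.


Section Critical.
Variables (k : R) (X : node -> R).
Hypothesis k_range : 0 < k <= kmax.
Hypothesis X_supp : supported free_nodes X.
Hypothesis X_ge0 : forall n, 0 <= X n.
Hypothesis X_neq0 : exists n, X n != 0.
Hypothesis X_stat : forall Y, supported free_nodes Y -> bilin k X Y = 0.
Hypothesis D_end : forall v a b,
  v \in vertices K -> v \in D -> a \in v -> b \in v -> a = b.

Let k_gt0 : 0 < k. Proof. by case/andP: k_range. Qed.
Let k_neq0 : k != 0. Proof. by rewrite gt_eqF. Qed.
Let k_le : 0 <= k <= kmax. Proof. by rewrite ltW //=; case/andP: k_range. Qed.

Let wgt_gt0 a : a.1 \in edges K -> 0 < half_weight a k.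
Proof. by move=> aK; rewrite half_weight_gt0 // inE. Qed.

Let sin_gt0 e : e \in edges K -> 0 < sin (k * half_len e).
Proof.
by move=> eK; rewrite sin_gt0_pi // mulr_gt0 ?half_len_gt0 //= half_angle_lt_pi.
Qed.

Lemma midpoint_balance e : e \in edges K ->
  \sum_(c : bool) half_weight (e, c) k *
    (X (vertex_node (e, c)) - half_cos (e, c) k * X (inr e)) = 0.
Proof.
move=> eK; rewrite -bilin_midpoint // X_stat // => n nf.
by case: eqP => // ne; move: nf; rewrite ne inE eK.
Qed.

Lemma vertex_balance v : v \in vertices K -> v \notin D ->
  \sum_(a in v) half_weight a k * (X (inr a.1) - half_cos a k * X (inl v)) = 0.
Proof.
move=> vK vD; rewrite -bilin_vertex // X_stat // => n nf.
by case: eqP => // ne; move: nf; rewrite ne inE vK vD.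
Qed.

Let sum0_term (I : finType) (P : pred I) (F : I -> R) :
  (forall i, P i -> 0 <= F i) -> \sum_(i | P i) F i = 0 ->
  forall i, P i -> F i = 0.
Proof.
move=> F0 /eqP; rewrite psumr_eq0 // => /allP h i Pi.
by have := h i (mem_index_enum _); rewrite Pi => /eqP.
Qed.

Let midpoint0 a : a.1 \in edges K -> X (inr a.1) = 0 -> X (vertex_node a) = 0.
Proof.
move=> aK y0; have := midpoint_balance aK.
under eq_bigr do rewrite y0 mulr0 subr0.
move=> /sum0_term/(_ a.2 isT); rewrite -surjective_pairing => h.
have /eqP : half_weight a k * X (vertex_node a) = 0.
  by apply: h => c _; rewrite mulr_ge0 ?X_ge0 // ltW // wgt_gt0.
by rewrite mulf_eq0 gt_eqF ?wgt_gt0 //= => /eqP.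
Qed.

Let vertex0 v a : v \in vertices K -> v \notin D -> a \in v ->
  X (inl v) = 0 -> X (inr a.1) = 0.
Proof.
move=> vK vD av x0; have := vertex_balance vK vD.
under eq_bigr do rewrite x0 mulr0 subr0.
move=> /sum0_term/(_ a av) h.
have /eqP : half_weight a k * X (inr a.1) = 0.
  apply: h => b bv; rewrite mulr_ge0 ?X_ge0 // ltW // wgt_gt0 //.
  exact: vertex_edge bv.
by rewrite mulf_eq0 gt_eqF ?wgt_gt0 ?(vertex_edge vK av) //= => /eqP.
Qed.

(** A strong maximum principle: by the balance at a node where the nonnegative
    vector vanishes, it vanishes at the neighbouring nodes.  The propagation
    through the whole graph would stop at a Dirichlet vertex of degree two or
    more; this is where Dirichlet vertices have to be leaves. *)
Lemma critical_midpoint_gt0 e : e \in edges K -> 0 < X (inr e).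
Proof.
move=> eK; rewrite lt_neqAle X_ge0 andbT eq_sym; apply/eqP => y0.
have all0 b : b.1 \in edges K -> X (inr b.1) = 0.
  move=> bK; suff : b \in [set b | X (inr b.1) == 0]%SET by rewrite inE => /eqP.
  apply: K_conn bK => [a _|v a b' vK av bv|].
  - by rewrite !inE.
  - rewrite !inE => /eqP a0; have [vD|vD] := boolP (v \in D).
      by rewrite -(D_end vK vD av bv) a0.
    rewrite (vertex0 vK vD bv) // -(vertex_nodeE vK av).
    exact: midpoint0 (vertex_edge vK av) a0.
  - by exists (e, true) => //; rewrite inE y0.
case: X_neq0 => n /eqP; apply.
case: (boolP (n \in free_nodes)) => [|/X_supp//].
case: n => [v|e']; rewrite inE; last by move=> ?; exact: (all0 (e', true)).
case/andP=> vK _; have [a av] := vertex_neq0 vK.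
rewrite -(vertex_nodeE vK av) midpoint0 ?all0 //; exact: vertex_edge av.
Qed.

Lemma critical_vertex_gt0 v : v \in vertices K -> v \notin D -> 0 < X (inl v).
Proof.
move=> vK vD; rewrite lt_neqAle X_ge0 andbT eq_sym; apply/eqP => x0.
have [a av] := vertex_neq0 vK.
by have := critical_midpoint_gt0 (vertex_edge vK av); rewrite (vertex0 vK vD av x0) ltxx.
Qed.

(** The sine coefficient of the expansion of the solution around the midpoint,
    whose cosine coefficient is the midpoint value. *)
Definition odd_part e : R :=
  (X (vertex_node (e, true)) - X (vertex_node (e, false))) / (2 * sin (k * half_len e)).

Definition ground e x : R :=
  X (inr e) * cos (k * (x - half_len e)) + odd_part e * sin (k * (x - half_len e)).

Definition dground e x : R :=
  k * (odd_part e * cos (k * (x - half_len e)) - X (inr e) * sin (k * (x - half_len e))).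

Lemma ground_derive e (x : R) : is_derive x 1 (ground e) (dground e x).
Proof. by rewrite /ground /dground; apply: is_derive_eq; rewrite /GRing.scale /=; ring. Qed.

Lemma dground_derive e (x : R) :
  is_derive x 1 (dground e) (- (k ^+ 2 * ground e x)).
Proof. by rewrite /ground /dground; apply: is_derive_eq; rewrite /GRing.scale /=; ring. Qed.

Let mid2 e : e \in edges K ->
  X (vertex_node (e, true)) + X (vertex_node (e, false)) =
  2 * cos (k * half_len e) * X (inr e).
Proof.
move=> eK; have := midpoint_balance eK; rewrite big_bool /half_weight /half_cos /=.
rewrite -mulrDr => /eqP; rewrite mulf_eq0 invr_eq0 -invr_eq0.
rewrite gt_eqF ?(wgt_gt0 (a := (e, true))) //= => /eqP; lra.
Qed.


Let xfE e : e \in edges K -> X (vertex_node (e, false)) =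
  2 * cos (k * half_len e) * X (inr e) - X (vertex_node (e, true)).
Proof. by move=> /mid2 <-; rewrite addrC addKr. Qed.

Let odd_partE e : e \in edges K -> odd_part e =
  (X (vertex_node (e, true)) - cos (k * half_len e) * X (inr e)) / sin (k * half_len e).
Proof.
move=> eK; rewrite /odd_part xfE //; field.
by rewrite gt_eqF // sin_gt0.
Qed.

Lemma ground_endpoint a : a.1 \in edges K ->
  @endpoint_value R E len ground a = X (vertex_node a).
Proof.
case: a => e c /= eK; rewrite /endpoint_value /ground /= odd_partE //.
have s0 : sin (k * half_len e) != 0 by rewrite gt_eqF // sin_gt0.
case: c => /=.
  by rewrite -(half_lenD e) addrK; field.
by rewrite sub0r mulrN cosN sinN xfE //; field.
Qed.

Lemma dground_endpoint a : a.1 \in edges K ->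
  @inward_derivative R E len dground a =
  half_weight a k * (X (inr a.1) - half_cos a k * X (vertex_node a)).
Proof.
case: a => e c /= eK; rewrite /inward_derivative /endpoint_value /dground /=.
rewrite half_weightE // /half_cos odd_partE //=.
have s0 : sin (k * half_len e) != 0 by rewrite gt_eqF // sin_gt0.
have cs : sin (k * half_len e) ^+ 2 = 1 - cos (k * half_len e) ^+ 2.
  by rewrite -(cos2Dsin2 (k * half_len e)) addrAC subrr add0r.
case: c => /=.
  by rewrite -(half_lenD e) addrK; field: cs.
by rewrite sub0r mulrN cosN sinN xfE //; field: cs.
Qed.

(** On each half edge the solution interpolates between its end values with the
    coefficients [sin (k (h - t))] and [sin (k t)], which are nonnegative since
    [k h] is less than [pi]. *)
Lemma ground_gt0 e x : e \in edges K -> 0 < x < (len e)%:num -> 0 < ground e x.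
Proof.
move=> eK /andP[x0 xl].
have s0 := sin_gt0 eK; have hl := half_lenD e.
have y0 := critical_midpoint_gt0 eK.
have main t xa : 0 <= t < half_len e -> 0 <= xa ->
    0 < X (inr e) * (sin (k * half_len e) * cos (k * t) -
                    cos (k * half_len e) * sin (k * t)) + xa * sin (k * t).
  move=> /andP[t0 th] xa0; rewrite -sinB -mulrBr.
  have lt_pi r : r <= half_len e -> k * r < pi.
    move=> rh; rewrite (le_lt_trans _ (half_angle_lt_pi eK k_le)) //.
    by rewrite ler_wpM2l // ltW.
  rewrite ltr_wpDr ?mulr_gt0 // ?mulr_ge0 //.
  - by apply: sin_ge0_pi; rewrite mulr_ge0 ?(ltW k_gt0) //= ltW // lt_pi // ltW.
  - apply: sin_gt0_pi; rewrite mulr_gt0 ?subr_gt0 //=.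
    by rewrite lt_pi // lerBlDr lerDl.
rewrite -(pmulr_rgt0 _ s0) /ground odd_partE // mulrDr [_ / _ * _]mulrAC.
rewrite [sin (k * half_len e) * (_ / _)]mulrC divfK ?gt_eqF //.
have [xh|xh] := leP (half_len e) x.
  have := main (x - half_len e) _ _ (X_ge0 (vertex_node (e, true))).
  move=> /(_ _)/lt_le_trans; apply; first by lra.
  by rewrite le_eqVlt; apply/orP; left; apply/eqP; ring.
have := main (half_len e - x) _ _ (X_ge0 (vertex_node (e, false))).
move=> /(_ _)/lt_le_trans; apply; first by lra.
rewrite -[x - _]opprB mulrN cosN sinN xfE //.
by rewrite le_eqVlt; apply/orP; left; apply/eqP; ring.
Qed.


Lemma ground_eigenpair : is_eigenpair K D (k ^+ 2) ground dground.
Proof.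
split=> [e _|e x _ _|v a b vK av bv|v a vK vD av|v vK vD].
- split; apply: derivable_within_continuous => x _.
    by have := ground_derive e x.
  by have := dground_derive e x.
- by split; [exact: ground_derive|exact: dground_derive].
- rewrite !ground_endpoint ?(vertex_edge vK) //.
  by rewrite (vertex_nodeE vK av) (vertex_nodeE vK bv).
- rewrite ground_endpoint ?(vertex_edge vK) // (vertex_nodeE vK av) X_supp //.
  by rewrite inE vD andbF.
- rewrite -[RHS](vertex_balance vK vD); apply: eq_bigr => a av.
  by rewrite dground_endpoint ?(vertex_edge vK) // (vertex_nodeE vK av).
Qed.

Lemma dground_gt0 v a : v \in vertices K -> v \in D -> a \in v ->
  0 < @inward_derivative R E len dground a.
Proof.
move=> vK vD av; have aK := vertex_edge vK av.
have xv0 : X (inl v) = 0 by apply: X_supp; rewrite inE vD andbF.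
rewrite dground_endpoint // (vertex_nodeE vK av) xv0.
by rewrite mulr0 subr0 mulr_gt0 ?wgt_gt0 ?critical_midpoint_gt0.
Qed.

Section Comparison.
Hypothesis X_min : forall k' Y, 0 <= k' < k -> supported free_nodes Y ->
  0 <= form k' Y -> forall n, Y n = 0.
Variables (nu : R) (f df : E -> R -> R).
Hypothesis f_pair : is_eigenpair K D nu f df.

Local Notation fval := (@endpoint_value R E len f).
Local Notation fder := (@inward_derivative R E len df).

Definition nodal_values : node -> R := fun n => match n with
  | inl v => if (v \in vertices K) && (v \notin D)
             then if [pick a in v] is Some a then fval a else 0 else 0
  | inr e => if e \in edges K then f e (half_len e) else 0
  end.

Let Y_supp : supported free_nodes nodal_values.
Proof. by case=> [v|e]; rewrite inE /= => /negbTE->. Qed.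

Let Y_vertex a : a.1 \in edges K -> nodal_values (vertex_node a) = fval a.
Proof.
case: f_pair => _ _ fc fD _ aK; have [v vK av] := vertex_at aK.
rewrite (vertex_nodeE vK av) /= vK /=; case: ifPn => [vD|/negPn vD].
  by case: pickP => [b bv|/(_ a)]; [exact: fc bv av|rewrite av].
by rewrite (fD v).
Qed.

Let Y_mid e : e \in edges K -> nodal_values (inr e) = f e (half_len e).
Proof. by move=> /= ->. Qed.

(* Continuity and the Kirchhoff condition cancel the boundary terms of the
   energy, vertex by vertex. *)
Let energy0 : \sum_(a in endpoints) fval a * fder a = 0.
Proof.
case: f_pair => _ _ fc fD fK; rewrite sum_over_vertices big1 // => v vK.
have [vD|vD] := boolP (v \in D).
  by rewrite big1 // => a av; rewrite (fD v) ?mul0r.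
have [b bv] := vertex_neq0 vK.
rewrite (eq_bigr (fun a => fval b * fder a)) => [|a av]; last by rewrite (fc v a b).
by rewrite -mulr_sumr fK // mulr0.
Qed.

Let in_half e : 0 <= half_len e <= (len e)%:num.
Proof. by have := half_lenD e; have := half_len_gt0 e; lra. Qed.

Let in_end a : 0 <= (@endpoint_pos R E len a).2 <= (len a.1)%:num.
Proof. by rewrite /endpoint_pos /=; case: a.2; rewrite ?lexx ltW. Qed.

(* The boundary terms of an edge have nonnegative sum by [nonpos_energy], and
   they add up to zero over all edges. *)
Let nonpos_constant : nu <= 0 -> forall e, e \in edges K ->
  forall x y, 0 <= x <= (len e)%:num -> 0 <= y <= (len e)%:num -> f e x = f e y.
Proof.
case: f_pair => freg fder _ _ _ nu0.
have en e (eK : e \in edges K) := nonpos_energy (freg _ eK).1 (freg _ eK).2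
  (fun x xl => (fder e x eK xl).1) (fun x xl => (fder e x eK xl).2) nu0
  (len_gt0 e).
have s0 : \sum_(e in edges K) (f e (len e)%:num * df e (len e)%:num - f e 0 * df e 0) = 0.
  apply/eqP; rewrite -oppr_eq0 -sumrN -[X in _ == X]energy0 sum_over_edges; apply/eqP.
  apply: eq_bigr => e _; rewrite /endpoint_value /inward_derivative /endpoint_value /=.
  ring.
have ge0 e : e \in edges K ->
    0 <= f e (len e)%:num * df e (len e)%:num - f e 0 * df e 0.
  by move=> eK; rewrite subr_ge0; case: (en _ eK).
move=> e eK; have [_] := en _ eK; apply.
by apply/esym/eqP; rewrite -subr_eq0; apply/eqP; exact: (sum0_term ge0 s0).
Qed.

(** Below the critical frequency, the form would vanish on the nodal values of
    the eigenfunction, hence so would these values, and with them the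
    eigenfunction on every edge.  For a nonpositive eigenvalue the form at
    frequency zero is used: the eigenfunction is then constant on each edge. *)
Lemma eigenvalue_lower_bound :
  (exists2 e, e \in edges K & @nonzero_on_edge R E len f e) -> k ^+ 2 <= nu.
Proof.
move=> [e eK [x xl fx]]; case: (f_pair) => freg fdr _ _ fK.
rewrite leNgt; apply/negP => nuk.
have [nu0|nu0] := leP nu 0.
  have fcst := nonpos_constant nu0.
  have Y0 : form 0 nodal_values = 0.
    rewrite /link_form /link_bilin big1 // => a; rewrite inE => aK.
    rewrite Y_vertex // /midpoint_node Y_mid // /endpoint_value.
    rewrite (fcst _ aK _ (half_len a.1)) // /half_cos mul0r cos0; ring.
  have := X_min (k' := 0) _ Y_supp _ (inr e); rewrite lexx k_gt0 Y0 lexx => /(_ isT isT).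
  rewrite Y_mid // => fh; move/eqP: fx; apply; rewrite -fh.
  exact: fcst.
pose r := Num.sqrt nu.
have r0 : 0 < r by rewrite sqrtr_gt0.
have rE : nu = r ^+ 2 by rewrite sqr_sqrtr // ltW.
have rk : r < k by rewrite -(ltr_pXn2r (n := 2)) ?nnegrE ?ltW // -rE.
have r_le : 0 <= r <= kmax by rewrite ltW //= (le_trans (ltW rk)); case/andP: k_le.
have sol e' (e'K : e' \in edges K) := helmholtz_solution (freg _ e'K).1 (freg _ e'K).2
  (fun x xl => (fdr e' x e'K xl).1) (fun x xl => (fdr e' x e'K xl).2)
  rE (lt0r_neq0 r0) (in_half e').
have sinr e' : e' \in edges K -> sin (r * half_len e') != 0.
  by move=> e'K; rewrite gt_eqF // sin_gt0_pi // mulr_gt0 ?half_len_gt0 //= half_angle_lt_pi.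
have flow a : a.1 \in edges K ->
    half_weight a r * (f a.1 (half_len a.1) - half_cos a r * fval a) = fder a /\
    half_weight a r * (fval a - half_cos a r * f a.1 (half_len a.1)) =
      if a.2 then df a.1 (half_len a.1) else - df a.1 (half_len a.1).
  move=> aK; rewrite half_weightE ?gt_eqF // /half_cos.
  have := sol _ _ aK (in_end a); have := sinr _ aK.
  have cs : sin (r * half_len a.1) ^+ 2 = 1 - cos (r * half_len a.1) ^+ 2.
    by rewrite -(cos2Dsin2 (r * half_len a.1)) addrAC subrr add0r.
  have rn0 : r != 0 by rewrite gt_eqF.
  rewrite /inward_derivative /endpoint_value /endpoint_pos.
  case: a aK cs => e' [] /= e'K cs s0.
  - have hE : (len e')%:num - half_len e' = half_len e' by rewrite -half_lenD addrK.
    by rewrite hE => -[-> ->]; split; field: cs; rewrite ?s0 ?rn0.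
  - by rewrite sub0r mulrN cosN sinN => -[-> ->]; split; field: cs; rewrite ?s0 ?rn0.
have Y0 : form r nodal_values = 0.
  transitivity (\sum_(a in endpoints) fval a * fder a +
    \sum_(a in endpoints) f a.1 (half_len a.1) *
      (if a.2 then df a.1 (half_len a.1) else - df a.1 (half_len a.1))).
    rewrite -big_split; apply: eq_bigr => a; rewrite inE => aK; cbv beta; rewrite [RHS]/=.
    have [<- <-] := flow _ aK; rewrite Y_vertex // /midpoint_node Y_mid //; ring.
  rewrite energy0 add0r sum_over_edges big1 // => e' _ /=; ring.
have Y0' n : nodal_values n = 0.
  by apply: (X_min (k' := r)) => //; [rewrite ltW|rewrite Y0].
have fh : f e (half_len e) = 0 by rewrite -Y_mid.
have ft : fval (e, true) = 0 by rewrite -Y_vertex.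
have [_] := flow (e, true) eK; rewrite ft fh mulr0 subr0 mulr0 /= => dfh.
move/eqP: fx; apply; have [-> _] := sol _ _ eK xl.
by rewrite fh -dfh !mul0r addr0.
Qed.

End Comparison.
End Critical.

End LongestEdge.


(** The eigenvalue of the positive eigenfunction is at least the first one, by
    minimality of the latter, and at most, by [eigenvalue_lower_bound]. *)
Lemma ground_state mu : edge_connected K -> edges K != finset.set0 ->
  (exists2 v, v \in vertices K & v \in D) ->
  (forall v a b, v \in vertices K -> v \in D -> a \in v -> b \in v -> a = b) ->
  is_lambda1 K D mu ->
  exists psi dpsi, [/\ is_eigenpair K D mu psi dpsi,
    forall e x, e \in edges K -> 0 < x < (len e)%:num -> 0 < psi e x,
    forall v a, v \in vertices K -> v \notin D -> a \in v ->
      0 < @endpoint_value R E len psi a &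
    forall v a, v \in vertices K -> v \in D -> a \in v ->
      0 < @inward_derivative R E len dpsi a].
Proof.
move=> Kc /set0Pn[e1 e1K] Dv De [[f [fn [df f_pair]]] mu_min].
have [e0 e0K e0_max] : exists2 e0, e0 \in edges K &
    forall e, e \in edges K -> (len e)%:num <= (len e0)%:num.
  case: (@Order.TotalTheory.arg_maxP _ _ _ e1 (mem (edges K)) (fun e => (len e)%:num) e1K).
  by move=> e0 e0K h; exists e0.
have [k [X [kr [Xs X0] Xn Xst Xm]]] := critical_frequency e0K e0_max Kc Dv.
have lo := eigenvalue_lower_bound e0_max kr Xm f_pair fn.
have gp := ground_eigenpair e0_max kr Xs Xst.
have gg := ground_gt0 e0_max Kc kr Xs X0 Xn Xst De.
have muE : mu = k ^+ 2.
  apply/eqP; rewrite eq_le lo andbT; apply: mu_min.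
  exists (ground k X); split; last by exists (dground k X).
  exists e1 => //; exists (half_len e1).
    by have := half_lenD e1; have := half_len_gt0 e1; lra.
  rewrite gt_eqF // gg //.
  by have := half_lenD e1; have := half_len_gt0 e1; lra.
exists (ground k X), (dground k X); split=> //.
- by rewrite muE.
- move=> v a vK vD av.
  rewrite (ground_endpoint e0_max kr Xst) ?(vertex_edge vK) // (vertex_nodeE vK av).
  exact: (critical_vertex_gt0 e0_max Kc kr Xs X0 Xn Xst De).
- exact: (dground_gt0 e0_max Kc kr Xs X0 Xn Xst De).
Qed.

End GroundState.

(** * Balancing the derivatives at the cut vertices *)

Section Balancing.
Context {R : realType} {E : finType} {len : E -> {posnum R}}.
Implicit Types (a b x y : E * bool) (v w u : {set E * bool}).
Variables (G H : metric_graph len).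
Hypothesis acyclic : ~ (exists c, is_cycle G c).
Hypothesis GH : refines G H.

(** The connectedness generated by this relation is that of the cut [H] after
    the vertices in [s] have been glued back together. *)
Definition glued (s : seq {set E * bool}) : rel (E * bool) := fun x y =>
  [|| y == other_endpoint x, same_vertex H x y | has (fun v => (x \in v) && (y \in v)) s].

Lemma glued_sym s : symmetric (glued s).
Proof.
move=> x y; rewrite /glued; congr [|| _, _ | _].
- by apply/eqP/eqP => ->; rewrite other_endpointK.
- by apply/same_vertexP/same_vertexP => -[v [? ? ?]]; exists v.
- by apply: eq_has => v; rewrite andbC.
Qed.

Lemma glued_separates s v a b : v \in vertices G -> v \notin s ->
  {subset s <= vertices G} ->
  (forall w x y, w \in vertices H -> x \in w -> y \in w -> x \in v -> x = y) ->
  a \in v -> b \in v -> connect (glued s) a b -> a = b.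
Proof.
move=> vG vs sG leaf av bv ab; apply: (vertex_separates acyclic vG av bv).
apply: (@connect_sub _ (glued s)) ab => x y.
case/or3P=> [/eqP->|/same_vertexP[w [wH xw yw]]|/hasP[u us /andP[xu yu]]].
- by apply: connect1; rewrite /step_avoiding eqxx.
- have [xv|xv] := boolP (x \in v); first by rewrite -(leaf w x y).
  have [u uG /fintype.subsetP wu] := GH wH.
  apply: connect1; rewrite /step_avoiding xv (same_vertexE _ uG (wu _ xw)) wu //.
  by rewrite orbT.
- have uG := sG _ us; apply: connect1.
  rewrite /step_avoiding (same_vertexE _ uG xu) yu /=; apply/orP; right.
  by apply: contra vs => xv; rewrite -(vertex_inj uG vG xu xv).
Qed.

(** Vertices are glued back one at a time. As the endpoints at the next vertex
    belong to distinct components of what has been glued so far, those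
    components can be rescaled independently, and nonzero numbers, at least two
    of them, can be rescaled to sum to zero. *)
Lemma balancing_coefficients (s : seq {set E * bool}) (d : E * bool -> R) :
  uniq s -> {subset s <= vertices G} ->
  (forall v, v \in s -> (1 < #|v|)%N) ->
  (forall v a, v \in s -> a \in v -> d a != 0) ->
  (forall v w x y, v \in s -> w \in vertices H -> x \in w -> y \in w ->
     x \in v -> x = y) ->
  exists c : E -> R, [/\ forall e, c e != 0,
    forall w a b, w \in vertices H -> a \in w -> b \in w -> c a.1 = c b.1 &
    forall v, v \in s -> \sum_(a in v) c a.1 * d a = 0].
Proof.
elim: s => [|v s IHs] /=.
  by move=> *; exists (fun=> 1); split=> [e|//|//]; exact: oner_neq0.
move=> /andP[vs us] sG s2 sd sleaf.
have sub u : u \in s -> u \in v :: s by move=> us'; rewrite inE us' orbT.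
have vv : v \in v :: s by rewrite inE eqxx.
have [||||c [c0 cH cs]] := IHs us.
- by move=> u /sub/sG.
- by move=> u /sub/s2.
- by move=> u a /sub; exact: sd.
- by move=> u w x y /sub; exact: sleaf.
have sep a b : a \in v -> b \in v -> connect (glued s) a b -> a = b.
  apply: glued_separates (sG _ vv) vs _ _; first by move=> u /sub/sG.
  by move=> w x y; exact: sleaf vv.
have v2 := s2 v vv.
have [a0 a0v] : exists a, a \in v by apply/card_gt0P; exact: ltnW.
pose tau a : R := if a == a0 then - (#|v|.-1)%:R else 1.
have tau0 a : tau a != 0.
  rewrite /tau; case: (a =P a0) => _; last exact: oner_neq0.
  by rewrite oppr_eq0 pnatr_eq0 -lt0n -subn1 subn_gt0.
have tau_sum : \sum_(a in v) tau a = 0.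
  rewrite (bigD1 a0) //= {1}/tau eqxx (eq_bigr (fun=> 1)) => [|a /andP[_ /negbTE aa]].
    rewrite sumr_const (cardD1 a0 (mem v)) a0v add1n /= addrC; apply/eqP.
    by rewrite subr_eq0 eqr_nat; apply/eqP/eq_card => a; rewrite !inE andbC.
  by rewrite /tau aa.
pose T e : R := if [pick a in v | connect (glued s) a (e, false)] is Some a
  then tau a / (c a.1 * d a) else 1.
have T0 e : T e != 0.
  rewrite /T; case: pickP => [a /andP[av _]|_]; last exact: oner_neq0.
  by rewrite mulf_neq0 // invr_eq0 mulf_neq0 // (sd v).
have half x : connect (glued s) x (x.1, false) && connect (glued s) (x.1, false) x.
  case: x => e []; last by rewrite !connect0.
  by apply/andP; split; apply: connect1; rewrite /glued eqxx.
have T_glued x y : connect (glued s) x y -> T x.1 = T y.1.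
  move=> xy; rewrite /T; congr (if _ is Some a then _ else _); apply: eq_pick => a.
  have yx : connect (glued s) y x by rewrite (sym_connect_sym (@glued_sym s)).
  have /andP[x1 x2] := half x; have /andP[y1 y2] := half y.
  congr andb; apply/idP/idP => h.
    by apply: connect_trans y1; apply: connect_trans xy; exact: connect_trans x2.
  by apply: connect_trans x1; apply: connect_trans yx; exact: connect_trans y2.
have T_at a : a \in v -> T a.1 = tau a / (c a.1 * d a).
  move=> av; rewrite /T; have /andP[aa aa'] := half a.
  case: pickP => [b /andP[bv ba]|/(_ a)]; last by rewrite av aa.
  by have -> : b = a by apply: sep => //; exact: connect_trans aa'.
exists (fun e => c e * T e); split.
- by move=> e; rewrite mulf_neq0.
- move=> w a b wH aw bw; rewrite (cH w a b) //; congr (_ * _).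
  apply: T_glued; apply: connect1; rewrite /glued.
  by apply/or3P/Or32/same_vertexP; exists w.
- move=> u; rewrite inE => /predU1P[->|us'].
    rewrite -[RHS]tau_sum; apply: eq_bigr => a av; rewrite T_at //.
    by field; rewrite c0 (sd v).
  (* [T] is constant at [u], whose endpoints are already glued together. *)
  have [b bu] : exists a, a \in u by apply/card_gt0P; apply: ltnW; exact/s2/sub.
  rewrite (eq_bigr (fun a => T b.1 * (c a.1 * d a))) => [|a au].
    by rewrite -mulr_sumr cs // mulr0.
  rewrite (T_glued a b); first by ring.
  apply: connect1; rewrite /glued; apply/or3P/Or33/hasP.
  by exists u => //; rewrite au.
Qed.

End Balancing.

(** * Gluing the ground states *)

Theorem theorem5p10 (R : realType) (E : finType) (len : E -> {posnum R})
  (G : metric_graph len) (k : nat) (P : 'I_k -> metric_graph len)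
  (G_tree : is_tree G)
  (k_ge2 : (2 <= k)%N)
  (P_exhaustive : is_exhaustive_partition G P)
  (P_interiors : has_connected_interiors G P)
  (P_equi : is_dirichlet_equipartition G P) :
  exists (mu : R) (psi : E -> R -> R),
    is_natural_eigenfunction G mu psi /\ is_nodal_partition G P psi.
Proof.
have [P_inj [H Hcut Hcomp]] := P_exhaustive.
have [/connected_edge_connected Gc acyc] := G_tree.
have [mu mu_min] := P_equi.
pose D i := dirichlet_vertices G (P i).
have GP i := @cluster_refines _ _ _ G k P H Hcut Hcomp i.
have GH : refines G H := Hcut.2.
have comp i : is_component H (P i) by apply/Hcomp; exists i.
have leaf i v w a b : v \in vertices G -> is_cut_vertex P v ->
    w \in vertices (P i) -> a \in w -> b \in w -> a \in v -> a = b.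
  exact: (cut_vertex_leaf acyc P_inj Hcut Hcomp P_interiors).
have DP i w : w \in vertices (P i) -> w \in D i ->
    exists v, [/\ v \in vertices G, is_cut_vertex P v & w \proper v].
  move=> wP; rewrite inE wP => /exists_inP[v vG wv]; exists v; split=> //.
  by apply/existsP; exists i; apply/exists_inP; exists w.
have ground i : exists pd : (E -> R -> R) * (E -> R -> R),
  [/\ is_eigenpair (P i) (D i) mu pd.1 pd.2,
    forall e x, e \in edges (P i) -> 0 < x < (len e)%:num -> 0 < pd.1 e x,
    forall v a, v \in vertices (P i) -> v \notin D i -> a \in v ->
      0 < @endpoint_value R E len pd.1 a &
    forall v a, v \in vertices (P i) -> v \in D i -> a \in v ->
      0 < @inward_derivative R E len pd.2 a].
  have [|||w a b wP wD aw bw|phi [dphi h]] := ground_state _ _ _ _ (mu_min i).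
  - exact: cluster_edge_connected Hcomp _.
  - by have [] := comp i.
  - exact: (cluster_dirichlet Gc k_ge2 P_inj Hcut Hcomp i).
  - have [v [vG vcut wv]] := DP _ _ wP wD.
    apply: (leaf i v w a b) => //.
    by move/proper_sub/fintype.subsetP: wv; apply.
  by exists (phi, dphi).
have [Psi PsiP] := boolp.choice ground.
pose own e := odflt (Ordinal (ltnW k_ge2 : 0 < k)%N) [pick i | e \in edges (P i)].
have ownE i e : e \in edges (P i) -> own e = i.
  move=> eP; rewrite /own; case: pickP => [j ej|/(_ i)] /=; last by rewrite eP.
  exact: (cluster_disjoint P_inj Hcomp ej eP).
have ownP e : e \in edges G -> e \in edges (P (own e)).
  by move=> /(cluster_of_edge Hcut Hcomp)[i ei]; rewrite (ownE i).
pose phi e := (Psi (own e)).1 e; pose dphi e := (Psi (own e)).2 e.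
pose d a := @inward_derivative R E len dphi a.
have cutP v a : v \in vertices G -> is_cut_vertex P v -> a \in v ->
    @endpoint_value R E len phi a = 0 /\ 0 < d a.
  move=> vG vcut av; have aP := ownP _ (vertex_edge vG av).
  have [w wP aw] := vertex_at aP; have [u uG wu] := GP _ w wP.
  have uv : u = v by apply: (vertex_inj uG vG _ av); exact: (fintype.subsetP wu).
  subst u; have wv := cut_vertex_cluster P_inj Hcomp vG vcut wP wu.
  have wD : w \in D (own a.1) by rewrite inE wP; apply/exists_inP; exists v.
  have [[_ _ _ PD _] _ _ dgt] := PsiP (own a.1).
  by split; [exact: PD wP wD aw|exact: dgt wP wD aw].
have uncutP v a : v \in vertices G -> ~~ is_cut_vertex P v -> a \in v ->
    v \in vertices (P (own a.1)) /\ v \notin D (own a.1).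
  move=> vG vcut av; have aP := ownP _ (vertex_edge vG av).
  have vP := uncut_vertex_cluster Hcut Hcomp vG vcut av aP; split=> //.
  apply/negP => /(DP _ _ vP)[v' [v'G _ vv']].
  have /fintype.subsetP/(_ _ av) av' := proper_sub vv'.
  by rewrite (vertex_inj vG v'G av av') finset.properEneq eqxx in vv'.
pose cuts := enum [set v in vertices G | is_cut_vertex P v]%SET.
have cutsE v : (v \in cuts) = (v \in vertices G) && is_cut_vertex P v.
  by rewrite mem_enum inE.
have [||||c [c0 cH cK]] := balancing_coefficients (d := d) acyc GH (enum_uniq _ : uniq cuts).
- by move=> v; rewrite cutsE => /andP[].
- move=> v; rewrite cutsE => /andP[vG /existsP[i /exists_inP[w wP]]].
  move=> /properP[/fintype.subsetP wv [b bv bw]].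
  have [a aw] := vertex_neq0 wP; apply/card_gt1P; exists a, b; split=> //; first exact: wv.
  by apply: contraNneq bw => <-.
- by move=> v a; rewrite cutsE => /andP[vG vcut] av; rewrite gt_eqF // (cutP v a vG vcut av).2.
- move=> v w x y; rewrite cutsE => /andP[vG vcut] wH xw yw xv.
  have xP := ownP _ (vertex_edge vG xv).
  have wP := component_vertex (comp _) wH xw xP.
  exact: (leaf _ v w x y vG vcut wP xw yw xv).
pose psi e x := c e * phi e x; pose dpsi e x := c e * dphi e x.
have uncut_own v a b : v \in vertices G -> ~~ is_cut_vertex P v -> a \in v -> b \in v ->
    own b.1 = own a.1 /\ c b.1 = c a.1.
  move=> vG vcut av bv; have [vP _] := uncutP v a vG vcut av.
  split; first by apply: ownE; exact: vertex_edge vP bv.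
  have [_ _ /fintype.subsetP VH _] := comp (own a.1).
  exact: cH (VH _ vP) bv av.
have nonzero e x : e \in edges G -> 0 < x < (len e)%:num -> psi e x != 0.
  move=> eG xl; rewrite mulf_neq0 // gt_eqF //.
  by have [_ h _ _] := PsiP (own e); exact: h (ownP _ eG) xl.
have nonzero_edge e : e \in edges G -> @nonzero_on_edge R E len psi e.
  move=> eG; have l0 : 0 < (len e)%:num by [].
  exists ((len e)%:num / 2); last apply: nonzero => //; lra.
exists mu, psi; split; first split.
- have [/set0Pn[e eP] _ _ _] := comp (Ordinal k_ge2).
  exists e; last apply: nonzero_edge; exact: refines_edge (GP _) eP.
- exists dpsi; split.
  + move=> e eG; have [[/(_ e (ownP _ eG))[pc dpc] _ _ _ _] _ _ _] := PsiP (own e).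
    by split=> x; apply: cvgM; [exact: cst_continuous|exact: pc|exact: cst_continuous|exact: dpc].
  + move=> e x eG xl; have [[_ /(_ e x (ownP _ eG) xl)[pd dpd] _ _ _] _ _ _] := PsiP (own e).
    split; first exact: is_deriveZ.
    by apply: is_derive_eq; rewrite /psi /phi /GRing.scale /=; ring.
  + move=> v a b vG av bv; rewrite /endpoint_value.
    have [vcut|vcut] := boolP (is_cut_vertex P v).
      have [pa _] := cutP v a vG vcut av; have [pb _] := cutP v b vG vcut bv.
      by rewrite /psi [phi _ _]pa [phi b.1 _]pb !mulr0.
    have [ob cb] := uncut_own v a b vG vcut av bv.
    have [vP vD] := uncutP v a vG vcut av.
    have [[_ _ pc _ _] _ _ _] := PsiP (own a.1).
    by rewrite /psi cb /phi ob; congr (_ * _); exact: pc vP av bv.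
  + by move=> v a _; rewrite inE.
  + move=> v vG _.
    have inE' a : @inward_derivative R E len dpsi a = c a.1 * d a.
      rewrite /d /inward_derivative /endpoint_value /dpsi.
      by case: a.2; rewrite ?mulrN.
    rewrite (eq_bigr _ (fun a _ => inE' a)).
    have [vcut|vcut] := boolP (is_cut_vertex P v); first by rewrite cK // cutsE vG.
    have [a av] := vertex_neq0 vG; have [vP vD] := uncutP v a vG vcut av.
    have [[_ _ _ _ pK] _ _ _] := PsiP (own a.1).
    rewrite (eq_bigr (fun b => c a.1 * @inward_derivative R E len (Psi (own a.1)).2 b)).
      by rewrite -mulr_sumr pK // mulr0.
    move=> b bv; have [ob ->] := uncut_own v a b vG vcut av bv.
    by rewrite /d /inward_derivative /endpoint_value /dphi ob.
have pG (p : graph_point G) : (val p).1 \in edges G by case/andP: (valP p).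
have full : partition_support G P = setT.
  apply/seteqP; split=> // p _; exists (own (val p).1) => //.
  exact/support_of_edge/ownP.
split.
- by split=> //; exists H.
- by split; [exact: (boundary_cut_set acyc Hcut Hcomp)|exact: P_interiors].
- rewrite full; apply/esym/seteqP; split=> // p _; exists p; first by left.
  by split; [exact: pG|exact/nonzero_edge/pG].
- rewrite full setTI; apply/seteqP; split=> p.
    move=> [v [vG [a av pa] [i [w wP wv]]]].
    change (psi (val p).1 (val p).2 = 0); rewrite pa.
    have vcut : is_cut_vertex P v.
      by apply/existsP; exists i; apply/exists_inP; exists w.
    by have [pa0 _] := cutP v a vG vcut av; rewrite /psi [phi _ _]pa0 mulr0.
  change (psi (val p).1 (val p).2 = 0 -> cut_set G P p) => p0.
  have [a pa] : exists a, val p = @endpoint_pos R E len a.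
    have := nonzero _ (val p).2 (pG p); rewrite p0 eqxx => nz.
    have /andP[_ /andP[x0 xl]] := valP p.
    have [x0'|x0'] := eqVneq (val p).2 0.
      by exists ((val p).1, false); rewrite [LHS]surjective_pairing x0'.
    have [xl'|xl'] := eqVneq (val p).2 (len (val p).1)%:num.
      by exists ((val p).1, true); rewrite [LHS]surjective_pairing xl'.
    suff : false by [].
    by apply: nz; rewrite !lt_neqAle eq_sym x0' x0 xl' xl.
  have aG : a.1 \in edges G by have := pG p; rewrite pa.
  have [v vG av] := vertex_at aG.
  have [vcut|vcut] := boolP (is_cut_vertex P v).
    have /existsP[i /exists_inP[w wP wv]] := vcut.
    by exists v; split=> //; [exists a|exists i; exists w].
  have [vP vD] := uncutP v a vG vcut av.
  have [_ _ pgt _] := PsiP (own a.1).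
  have := pgt v a vP vD av; move/eqP: p0.
  rewrite pa /psi mulf_eq0 (negbTE (c0 _)) /= => /eqP pz.
  by rewrite /endpoint_value -[X in _ < X]/(phi a.1 _) pz ltxx.
Qed.
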